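(* Let $\mathbb{B}$ be a UMD Banach space. There is a constant $C$ depending only on $\mathbb{B}$ such that for every $\Omega\in\mathbb{D}_{1,0}$ with $|\Omega|=4^N$ for some integer $N$, every $f\in L_1(\mathbb{R};\mathbb{B})$ and every sequence $\gamma=(\gamma(I))_{I\in\mathbb{D}_{1,0}}$ with $|\gamma(I)|\le1$, $$\Big\|\sup_{n\ge0}\|g_n^\Omega\|_{\mathbb{B}}\Big\|_{L_{1,\infty}(\Omega)}\le C\,\|f\|_{L_1(\Omega;\mathbb{B})}.$$
   Context: A Banach space $\mathbb{B}$ is UMD if for some (equivalently all) $1<p<\infty$ there is $c_{p,\mathbb{B}}$ such that for every $\mathbb{B}$-valued martingale difference sequence $(d_k)$ on any filtered probability space and every deterministic $(\varepsilon_k)\subset[-1,1]$, $\|\sum_{k=0}^n\varepsilon_kd_k\|_{L_p(\mathbb{B})}\le c_{p,\mathbb{B}}\|\sum_{k=0}^nd_k\|_{L_p(\mathbb{B})}$. $\mathbb{D}_{1,0}=\{2^n([0,1)+k):n,k\in\mathbb{Z}\}$ is the standard dyadic lattice; $I\in\mathbb{D}_{1,0}$ is even if $\log_2|I|$ is even. Let $\varphi,\psi$ be supported on $[0,1]$ with $\varphi=-1$ on $[0,1/4)$, $1$ on $[1/4,3/4)$, $-1$ on $[3/4,1]$, and $\psi=7$ on $(0,1/4)$, $-1$ on $[1/4,1/2)$, $1$ on $[1/2,3/4)$, $-7$ on $[3/4,1]$; for an interval $I$ with endpoints $a<b$, $h_I(x)=(b-a)^{-1/2}h(\frac{x-a}{b-a})$;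 $\langle f,g\rangle=\int fg$. For $\Omega$ as in the claim, define the filtration on $\Omega$ by $\mathcal{F}_0^\Omega=\{\emptyset,\Omega\}$ and for $n\ge0$: $\mathcal{F}_{2n+1}^\Omega=\sigma(\{\varphi_I: I \text{ a dyadic subinterval of }\Omega,\ |I|=4^{-n}|\Omega|\})$, $\mathcal{F}_{2n+2}^\Omega=\sigma(\{\psi_I: I\text{ a dyadic subinterval of }\Omega,\ |I|=4^{-n}|\Omega|\})$. Let $g^\Omega=\sum_{I\in\mathbb{D}_{1,0},\,I\subseteq\Omega,\,I\text{ even}}\gamma(I)\langle f,\varphi_I\rangle\psi_I$ and let $(g_n^\Omega)_{n\ge0}$ be the martingale $g_n^\Omega=\mathbb{E}[g^\Omega|_\Omega\mid\mathcal{F}_n^\Omega]$ on $\Omega$ with Lebesgue measure. $\|h\|_{L_{1,\infty}(\Omega)}=\sup_{\lambda>0}\lambda\,|\{\omega\in\Omega:|h(\omega)|\ge\lambda\}|$ and $\|f\|_{L_1(\Omega;\mathbb{B})}=\int_\Omega\|f\|_{\mathbb{B}}$. *)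

(* Defs.v *)
From HB Require Import structures.
From mathcomp Require Import all_boot all_order all_algebra.
From mathcomp Require Import all_classical all_reals all_analysis.
Set Implicit Arguments. Unset Strict Implicit. Unset Printing Implicit Defensive.
Import Order.TTheory GRing.Theory Num.Theory.
Import numFieldNormedType.Exports.
Local Open Scope classical_set_scope.
Local Open Scope ring_scope.

Section Bochner.
Context {R : realType} {B : completeNormedModType R}.

Definition sfun_eval {T : Type} (s : seq (set T * B)) (x : T) : B :=
  \sum_(p <- s) (\1_(p.1) x : R) *: p.2.

Definition strongly_meas {T : Type} (G : set (set T)) (D : set T) (h : T -> B) :=
  exists s : nat -> seq (set T * B),
    (forall n p, p \in s n -> G p.1) /\
    (forall x, D x -> sfun_eval (s n) x @[n --> \oo] --> h x).

Definition is_bochner {d} {T : measurableType d}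
    (mu : {measure set T -> \bar R}) (D : set T) (h : T -> B) (v : B) :=
  exists s : nat -> seq (set T * B),
    (forall n p, p \in s n -> measurable p.1 /\ (mu (p.1 `&` D) < +oo)%E) /\
    (forall x, D x -> sfun_eval (s n) x @[n --> \oo] --> h x) /\
    ((\int[mu]_(x in D) (`|h x - sfun_eval (s n) x|)%:E)%E @[n --> \oo]
       --> 0%E) /\
    (\sum_(p <- s n) fine (mu (p.1 `&` D)) *: p.2) @[n --> \oo] --> v.

Definition bochner_integrable {d} {T : measurableType d}
    (mu : {measure set T -> \bar R}) (D : set T) (h : T -> B) :=
  exists v, is_bochner mu D h v.

Definition bochner {d} {T : measurableType d}
    (mu : {measure set T -> \bar R}) (D : set T) (h : T -> B) : B :=
  xget 0 [set v | is_bochner mu D h v].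

End Bochner.

Section UMD.
Context {R : realType}.

Definition filtration {d} {T : measurableType d} (F : nat -> set (set T)) :=
  forall n, sigma_algebra setT (F n) /\ F n `<=` measurable /\ F n `<=` F n.+1.

(** (d_k) is a B-valued L_p martingale difference sequence w.r.t. F:
    d_k is F_k-strongly measurable, in L_p, and E[d_{k+1} | F_k] = 0,
    i.e. the integral of d_{k+1} over every A in F_k vanishes. *)
Definition mds {d} {T : measurableType d} {B : completeNormedModType R}
    (P : probability T R) (F : nat -> set (set T)) (p : R)
    (dd : nat -> T -> B) :=
  forall k,
    strongly_meas (F k) setT (dd k) /\
    (\int[P]_x ((`|dd k x| `^ p)%:E) < +oo)%E /\
    (forall A, F k A -> is_bochner P A (dd k.+1) 0).

Definition UMD (B : completeNormedModType R) : Prop :=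
  exists p : R, 1 < p /\ exists c : R,
    forall (d : measure_display) (T : measurableType d) (P : probability T R)
      (F : nat -> set (set T)) (dd : nat -> T -> B),
      filtration F -> mds P F p dd ->
      forall (eps : nat -> R), (forall k, -1 <= eps k <= 1) ->
      forall n : nat,
      (Lnorm P p%:E (fun x => (`|\sum_(k < n.+1) eps k *: dd k x|)%:E)
        <= c%:E * Lnorm P p%:E (fun x => (`|\sum_(k < n.+1) dd k x|)%:E))%E.

End UMD.

Section Dyadic.
Context {R : realType}.

Definition dI (n k : int) : set R :=
  [set x | (2:R) ^ n * k%:~R <= x < (2:R) ^ n * (k + 1)%:~R].

Definition phi (x : R) : R :=
  if (0 <= x < 1/4) then -1 else if (1/4 <= x < 3/4) then 1
  else if (3/4 <= x <= 1) then -1 else 0.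

Definition psi (x : R) : R :=
  if (0 < x < 1/4) then 7 else if (1/4 <= x < 1/2) then -1
  else if (1/2 <= x < 3/4) then 1 else if (3/4 <= x <= 1) then -7 else 0.

Definition hI (h : R -> R) (a b : R) (x : R) : R :=
  (Num.sqrt (b - a))^-1 * h ((x - a) / (b - a)).

Definition hD (h : R -> R) (n k : int) : R -> R :=
  hI h ((2:R) ^ n * k%:~R) ((2:R) ^ n * (k + 1)%:~R).

Definition Omega (N k : int) : set R := dI (2 * N) k.

(** generators of F_{2n+1} (h = phi) and F_{2n+2} (h = psi):
    the sets Omega /\ h_I^{-1}(A), A Borel, I dyadic subinterval of Omega
    with |I| = 4^{-n}|Omega|, i.e. I = dI (2N - 2n) j. *)
Definition gens (h : R -> R) (N k : int) (n : nat) : set (set R) :=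
  [set S | exists (j : int) (A : set R),
     dI (2 * N - 2 * n%:Z) j `<=` Omega N k /\ measurable A /\
     S = Omega N k `&` (hD h (2 * N - 2 * n%:Z) j @^-1` A)].

Definition FOm (N k : int) (i : nat) : set (set R) :=
  if i == 0%N then [set S | S = set0 \/ S = Omega N k]
  else if odd i then <<s Omega N k, gens phi N k i.-1./2 >>
  else <<s Omega N k, gens psi N k i.-1./2 >>.

End Dyadic.

Section Martingale.
Context {R : realType} {B : completeNormedModType R}.
Local Open Scope ereal_scope.

Definition leb := (@lebesgue_measure R).

Definition pairing (f : R -> B) (h : R -> R) (n k : int) : B :=
  bochner leb setT (fun x => hD h n k x *: f x).

Definition evenSub (N k : int) (l : nat) : set (int * int) :=
 
  [set I | (I.1 = 2 * N - 2 * l%:Z)%R /\ @dI R I.1 I.2 `<=` Omega N k].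

(** [gi] is a version of E[g^Omega | F_i^Omega], with
    g^Omega = sum over even I in Omega of gamma(I) <f,phi_I> psi_I,
    the conditional expectation taken termwise: gi is F_i-strongly
    measurable on Omega and for every A in F_i, the integral of gi over A
    equals sum_I gamma(I) <f,phi_I> int_A psi_I (summed by size of I). *)
Definition cond_exp_version (N k : int) (f : R -> B) (gamma : int * int -> R)
    (i : nat) (gi : R -> B) :=
  strongly_meas (FOm N k i) (Omega N k) gi /\
  forall A, FOm N k i A ->
    exists v : B, is_bochner leb A gi v /\
      (\sum_(l < L) \sum_(I \in evenSub N k l)
          (fine (\int[leb]_(x in A) (hD psi I.1 I.2 x)%:E) * gamma I)
            *: pairing f phi I.1 I.2)%R @[L --> \oo] --> v.

Definition weakL1 (Om : set R) (h : R -> \bar R) : \bar R :=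
  ereal_sup [set (lam%:E * leb [set w | Om w /\ lam%:E <= `|h w|])
            | lam in [set lam : R | (0 < lam)%R]].

End Martingale.

(* Main.v *)
Require Import Defs.
From HB Require Import structures.
From mathcomp Require Import all_boot all_order all_algebra.
From mathcomp Require Import all_classical all_reals all_analysis.
From mathcomp Require Import measurable_realfun ring lra zify.
Set Implicit Arguments. Unset Strict Implicit. Unset Printing Implicit Defensive.
Import Order.TTheory GRing.Theory Num.Theory.
Import numFieldNormedType.Exports.
Local Open Scope classical_set_scope.
Local Open Scope ring_scope.

(** Off a null set, both g_{2m} and g_{2m+1} equal the partial sum of
    gamma(I) <f, phi_I> psi_I over the intervals I of length greater than
    4^{-m}|Omega|.  Coding the 4-adic subintervals of Omega by words in four
    letters turns these sums into martingale transforms on the finite space of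
    words of length M, driven by the averages of f.

    On the four quarters of I one has phi = (-1,1,1,-1), psi = (7,-1,1,-7).
    The splittings phi = (0,1,0,-1) + (-1,0,1,0) = (-1,1,0,0) + (0,0,1,-1)
    both have conditionally symmetric pieces, so the UMD inequality allows
    their signs to be changed, and
    psi = 3 ((0,1,0,-1) - (-1,0,1,0)) + 4 ((0,0,1,-1) - (-1,1,0,0)).
    Visiting the intervals one at a time makes the factors gamma(I)
    deterministic multipliers of martingale differences.

    For the weak type bound at height lambda one stops as soon as the average
    of |f| exceeds lambda or the norm of the partial sum reaches lambda.  The
    stopped averages of f are at most 4 lambda and keep their L_1 norm, so the
    L_p bound controls the points stopped by the partial sums, while Markov's
    inequality for the stopped averages of |f| controls the others. *)

(** * Conditionally symmetric increments on a finite probability space *)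

(** On one interval phi and psi are linearly independent, so no scalar multiplier turns one into the
    other: phi is even and psi odd under reversal of the quarters. The odd patterns form the plane
    spanned by (1,1,-1,-1) and (1,-1,1,-1), which are the differences of the two pieces in the two
    splittings of phi; solving for (7,-1,1,-7) in this basis gives 3 and 4.

    Conditional expectations on the space of words are avoided: a permutation that reverses one
    increment and keeps the earlier ones already makes the required integrals vanish.

    The functions g_n are arbitrary versions, yet their values off the interval endpoints are
    forced, since a strongly measurable function is constant on an atom. The atoms of odd index are
    pairs of mirror quarters, over which psi cancels; hence g_{2m+1} contains no more terms than
    g_{2m}. *)

Definition finspace (T : finType) (x0 : T) : Type := T.

Section FiniteSpace.
Context (R : realType) (T : finType) (x0 : T).

HB.instance Definition _ := Finite.copy (finspace x0) T.
HB.instance Definition _ := isPointed.Build (finspace x0) x0.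
HB.instance Definition _ := @isMeasurable.Build default_measure_display
  (finspace x0) (@discrete_measurable _) (@discrete_measurable0 _)
  (@discrete_measurableC _) (@discrete_measurableU _).

(** A scaled sum of Dirac masses, so that the measure axioms are inherited; [x0] also serves as the
    default of [nth]. *)
Definition unif : set (finspace x0) -> \bar R :=
  mscale ((#|T|%:R^-1 : R)%:nng)%R
    (msum (fun i => @dirac _ (finspace x0) (nth x0 (enum T) i) R) #|T|).

HB.instance Definition _ := Measure.on unif.

Lemma big_enum_ord (V : nmodType) (F : T -> V) :
  \sum_(i < #|T|) F (nth x0 (enum T) i) = \sum_x F x.
Proof.
by rewrite cardE -(big_mkord predT (fun i => F (nth x0 (enum T) i)))
  -(big_nth x0 predT) big_enum.
Qed.

Lemma unifE (A : set (finspace x0)) :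
  unif A = (#|T|%:R^-1 * \sum_(x : T) \1_A x)%:E.
Proof.
rewrite /unif /mscale /msum EFinM; congr (_ * _)%E.
by rewrite -big_enum_ord -sumEFin; exact: eq_bigr.
Qed.

Lemma card_space_gt0 : (0 < #|T|%:R :> R).
Proof. by rewrite ltr0n; apply/card_gt0P; exists x0. Qed.

Lemma unif_setT : unif setT = 1%E.
Proof.
rewrite unifE; under eq_bigr do rewrite indicT.
rewrite sumr_const -[X in _ * X]/(#|T|%:R) mulVf ?gt_eqF//.
exact: card_space_gt0.
Qed.

HB.instance Definition _ := Measure_isProbability.Build _ _ _ unif unif_setT.

Lemma integral_unif (f : T -> R) : (forall x, 0 <= f x) ->
  (\int[unif]_(x in setT) (f x)%:E = (#|T|%:R^-1 * \sum_x f x)%:E)%E.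
Proof.
move=> f0; rewrite ge0_integral_mscale//=; last by move=> x _; rewrite lee_fin.
rewrite ge0_integral_measure_sum//; last by move=> x _; rewrite lee_fin.
rewrite EFinM; congr (_ * _)%E; rewrite -big_enum_ord -sumEFin.
by apply: eq_bigr => i _; rewrite integral_dirac// diracT mul1e.
Qed.

Context (B : completeNormedModType R).

(** [undup] lists every value once, so exactly one indicator is nonzero at each point and the simple
    function reproduces [h]. *)
Definition level_sets (h : T -> B) : seq (set (finspace x0) * B) :=
  [seq ([set x | h x = v], v) | v <- undup (map h (enum T))].

Lemma sfun_eval_level_sets (h : T -> B) (x : T) :
  sfun_eval (level_sets h) x = h x.
Proof.
rewrite /sfun_eval big_map (bigD1_seq (h x)) ?undup_uniq//=; last first.
  by rewrite mem_undup map_f// mem_enum.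
rewrite indicE mem_set//= scale1r big1 ?addr0// => v vx.
by rewrite indicE memNset ?scale0r// => /= /esym/eqP; rewrite (negbTE vx).
Qed.

Lemma is_bochner_unif (A : set (finspace x0)) (h : T -> B) :
  \sum_(x : T) (\1_A x : R) *: h x = 0 -> is_bochner unif A h 0.
Proof.
move=> h0; exists (fun=> level_sets h); split.
  move=> _ q _; split=> //.
  by apply: (le_lt_trans (probability_le1 _ _)) => //; rewrite ltry.
split; first by move=> x _; rewrite sfun_eval_level_sets; exact: cvg_cst.
split.
  rewrite (_ : (fun _ => _) = fun=> 0%E); first exact: cvg_cst.
  apply/funext => _; apply: integral0_eq => x _.
  by rewrite sfun_eval_level_sets subrr normr0.
rewrite (_ : (fun _ => _) = fun=> 0); first exact: cvg_cst.
apply/funext => _.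
transitivity ((#|T|%:R^-1 : R) *: \sum_(x : T) (\1_A x : R) *: h x); last first.
  by rewrite h0 scaler0.
transitivity (\sum_(q <- level_sets h) \sum_(x : T)
    (#|T|%:R^-1 * \1_(q.1 `&` A) x : R) *: q.2).
  apply: eq_bigr => q _; rewrite (_ : fine _ = fine (unif (q.1 `&` A)))//.
  by rewrite unifE /= mulr_sumr scaler_suml.
rewrite exchange_big /= scaler_sumr.
apply: eq_bigr => x _.
rewrite -[in RHS](sfun_eval_level_sets h x) /sfun_eval !scaler_sumr.
by apply: eq_bigr => q _; rewrite indicI /= !scalerA; congr (_ *: _); ring.
Qed.

(** The sigma-algebra generated by the increments up to k: on a finite space it consists of the
    unions of joint level sets, which saturation expresses without generators. *)
Definition history (dd : nat -> T -> B) (k : nat) : set (set (finspace x0)) :=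
  [set A | forall x y : T, (forall j, (j <= k)%N -> dd j x = dd j y) -> A x -> A y].

Lemma filtration_history (dd : nat -> T -> B) :
  filtration (history dd : nat -> set (set (finspace x0))).
Proof.
move=> n; split; [split=> //|split=> //].
- by move=> A hA x y xy [_ Ax]; split=> // Ay; apply: Ax; apply: (hA y) => // j /xy.
- by move=> F hF x y xy [i _ Fx]; exists i => //; exact: (hF i x).
- by move=> A hA x y xy; apply: hA => j jn; apply: xy; rewrite leqW.
Qed.

(* [s k] reflects the k-th increment and leaves the earlier ones unchanged,
   so the increments are conditionally symmetric. *)
Definition symmetric_increments (dd : nat -> T -> B) :=
  forall k, exists s : T -> T, [/\ injective s,
    forall j x, (j <= k)%N -> dd j (s x) = dd j x &
    forall x, dd k.+1 (s x) = - dd k.+1 x].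

(** The map [s] permutes the space, preserves each set of the history and reverses the next
    increment, so the integral of that increment over such a set equals its own opposite. *)
Lemma mds_symmetric (p : R) (dd : nat -> T -> B) :
  symmetric_increments dd -> mds (unif : probability _ _) (history dd) p dd.
Proof.
move=> ddS k; split; [|split].
- exists (fun=> level_sets (dd k)); split; last first.
    by move=> x _; rewrite sfun_eval_level_sets; exact: cvg_cst.
  by move=> _ q /mapP[v _ ->] x y /= xy <-; rewrite xy.
- by rewrite integral_unif ?ltry// => x; exact: powR_ge0.
- move=> A hA; apply: is_bochner_unif.
  have [s [s_inj sj sk]] := ddS k.
  set S := LHS; have S_opp : S = - S.
    rewrite {1}/S (reindex_inj s_inj)/= -sumrN; apply: eq_bigr => x _.
    rewrite sk scalerN; congr (- (_ *: _)); rewrite !indicE.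
    congr ((nat_of_bool _)%:R); apply/idP/idP; rewrite !inE; apply: hA => j jk.
      by rewrite sj.
    by rewrite sj.
  have : (2 : R) *: S = 0 by rewrite scaler_nat mulr2n {2}S_opp subrr.
  by move/eqP; rewrite scaler_eq0 pnatr_eq0 => /eqP.
Qed.

End FiniteSpace.
Arguments unif R {T} x0 _.


Lemma Lnorm_unif {R : realType} (T : finType) (x0 : T) (p : R) (h : T -> R) :
  p != 0 -> (Lnorm (unif R x0) p%:E (EFin \o h) `^ p =
    (#|T|%:R^-1 * \sum_x `|h x| `^ p)%:E)%E.
Proof.
move=> p0; rewrite poweR_Lnorm// -(integral_unif x0)// => x; exact: powR_ge0.
Qed.

Lemma UMD_symmetric {R : realType} (B : completeNormedModType R) : UMD B ->
  exists p : R, 1 < p /\ exists C : R, 0 <= C /\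
    forall (T : finType) (x0 : T) (dd : nat -> T -> B),
      symmetric_increments dd ->
      forall eps : nat -> R, (forall k, -1 <= eps k <= 1) ->
      forall n, \sum_x `|\sum_(k < n.+1) eps k *: dd k x| `^ p <=
        C * \sum_x `|\sum_(k < n.+1) dd k x| `^ p.
Proof.
move=> [p [p1 [c umd]]]; exists p; split=> //.
exists (`|c| `^ p); split; first exact: powR_ge0.
move=> T x0 dd ddS eps eps1 n.
have p0 : 0 < p by rewrite (lt_trans _ p1).
have := umd _ _ (unif R x0) _ dd (filtration_history x0 dd)
  (mds_symmetric x0 p ddS) eps eps1 n.
set f := fun x : T => `|\sum_(k < n.+1) eps k *: dd k x|.
set g := fun x : T => `|\sum_(k < n.+1) dd k x|.
move=> fg.
(* The sign of [c] is unknown; [|c|] keeps the right-hand side nonnegative before the power p is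
   taken. *)
have {}fg : (Lnorm (unif R x0) p%:E (EFin \o f) <=
    `|c|%:E * Lnorm (unif R x0) p%:E (EFin \o g))%E.
  apply: (le_trans fg); apply: lee_wpmul2r; first exact: Lnorm_ge0.
  by rewrite lee_fin ler_norm.
have : (Lnorm (unif R x0) p%:E (EFin \o f) `^ p <=
    (`|c|%:E * Lnorm (unif R x0) p%:E (EFin \o g)) `^ p)%E.
  apply: gt0_ler_poweR => //; rewrite ?ltW// in_itv/= leey andbT.
    exact: Lnorm_ge0.
  by rewrite mule_ge0// Lnorm_ge0.
rewrite poweRM ?Lnorm_ge0//.
rewrite !Lnorm_unif ?gt_eqF// -EFinM lee_fin mulrCA ler_pM2l; last first.
  by rewrite invr_gt0; exact: card_space_gt0 x0.
rewrite /f /g; under eq_bigr do rewrite normr_id.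
by under [X in _ <= _ * X]eq_bigr do rewrite normr_id.
Qed.

(** * Increments indexed by the nodes of the 4-ary tree *)

Notation word := (seq 'I_4).
Notation letter x l := (nth (@ord0 3) x l).

Section Tree.
Context (M : nat).
Implicit Types (x y : M.-tuple 'I_4) (u w : word) (s : 'I_4 -> 'I_4).

(** The map [s] acts on letters at the single node [u]; words that do not pass through [u] stay
    fixed. *)
Definition act u s x : M.-tuple 'I_4 :=
  if take (size u) x == u
  then [tuple if (i == size u :> nat) then s (tnth x i) else tnth x i | i < M]
  else x.

Lemma letter_act u s x l : (l < M)%N ->
  letter (act u s x) l =
  if (take (size u) x == u) && (l == size u) then s (letter x l) else letter x l.
Proof.
move=> lM; rewrite /act; case: ifP => // _.
have -> y : letter y l = tnth y (Ordinal lM) by rewrite (tnth_nth ord0).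
by rewrite tnth_mktuple (tnth_nth ord0).
Qed.

Lemma take_act u s x l : (l <= size u)%N -> take l (act u s x) = take l x.
Proof.
move=> lu; apply: (@eq_from_nth _ ord0); first by rewrite !size_take !size_tuple.
move=> i; rewrite size_take size_tuple => il.
have [il' iM] : (i < l)%N /\ (i < M)%N by move: il; case: ifP; lia.
rewrite !nth_take// letter_act//; case: ifP => // /andP[_ /eqP iu]; lia.
Qed.

Lemma act_inj u s : injective s -> injective (act u s).
Proof.
move=> s_inj x y xy; have txy : take (size u) x = take (size u) y.
  by rewrite -(take_act s x (leqnn _)) xy take_act.
apply: val_inj; apply: (@eq_from_nth _ ord0); first by rewrite !size_tuple.
move=> i; rewrite size_tuple => iM.
have := congr1 (fun z : M.-tuple _ => letter z i) xy.
by rewrite !letter_act// txy; case: ifP => // _ /s_inj.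
Qed.

Definition words l : seq word := [seq tval t | t <- enum {: l.-tuple 'I_4}].

Lemma mem_words l u : (u \in words l) = (size u == l).
Proof.
apply/mapP/eqP => [[t _ ->]|ul]; first exact: size_tuple.
by exists (Tuple (introT eqP ul)); rewrite ?mem_enum.
Qed.

Lemma uniq_words l : uniq (words l).
Proof. by rewrite map_inj_uniq ?enum_uniq//; exact: val_inj. Qed.

Fixpoint nodes n : seq word := if n is m.+1 then nodes m ++ words m else [::].

Lemma mem_nodes n u : (u \in nodes n) = (size u < n)%N.
Proof.
elim: n => //= n ih; rewrite mem_cat ih mem_words; lia.
Qed.

(** This order makes a reflection at one node harmless for the increments revealed earlier, through
    [node_fun_act_lt]. *)
Lemma pairwise_nodes n :
  pairwise (fun w u => (size w <= size u)%N && (w != u)) (nodes n).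
Proof.
elim: n => //= n ih; rewrite pairwise_cat ih /=; apply/andP; split.
  apply/allrelP => w u; rewrite mem_nodes mem_words => wn /eqP un.
  by rewrite un ltnW//=; apply: contraTneq wn => ->; rewrite un ltnn.
have := uniq_words n; rewrite uniq_pairwise; apply: (@sub_in_pairwise _ (mem (words n))); last by apply/allP.
by move=> w u; rewrite !mem_words => /eqP -> /eqP -> /= ->; rewrite leqnn.
Qed.

Context (V : zmodType).
Implicit Types (h : word -> 'I_4 -> V).

Definition node_fun h u x : V :=
  if take (size u) x == u then h u (letter x (size u)) else 0.

(** An action at [u] alters only the letter at depth [size u] of words through [u]. The increment at
    [w] reads a shallower letter, or else lives on words that avoid [u]. *)
Lemma node_fun_act_lt h u w s x : (size w <= size u)%N -> w != u ->
  (size u < M)%N -> node_fun h w (act u s x) = node_fun h w x.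
Proof.
move=> wu neq uM; rewrite /node_fun take_act//; case: ifP => // /eqP xw.
rewrite letter_act ?(leq_ltn_trans wu)//; case: ifP => // /andP[/eqP xu /eqP e].
by move: neq; rewrite -xw -xu e eqxx.
Qed.

Lemma node_fun_act h u s x : (size u < M)%N ->
  node_fun h u (act u s x) = node_fun (fun v a => h v (s a)) u x.
Proof.
move=> uM; rewrite /node_fun take_act// letter_act// eqxx andbT.
by case: (_ == u).
Qed.

(** Each word passes through exactly one node of each depth. *)
Lemma sum_nodes h x n : (n <= M)%N ->
  \sum_(u <- nodes n) node_fun h u x =
  \sum_(l < n) h (take l x) (letter x l).
Proof.
elim: n => [|n ih] nM; first by rewrite big_nil big_ord0.
rewrite /= big_cat ih 1?ltnW//= big_ord_recr /=; congr (_ + _).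
have sn : size (take n x) = n by rewrite size_take size_tuple nM.
rewrite (bigD1_seq (take n x)) ?uniq_words ?mem_words ?sn//=.
rewrite /node_fun sn eqxx big_seq_cond big1 ?addr0// => u.
rewrite mem_words => /andP[/eqP un ux]; rewrite un.
by rewrite eq_sym (negbTE ux).
Qed.

Lemma sum_double (F : nat -> V) n :
  \sum_(k < n.*2) F k = \sum_(i < n) (F i.*2 + F i.*2.+1).
Proof.
elim: n => [|n ih]; first by rewrite !big_ord0.
by rewrite doubleS !big_ord_recr /= ih addrA.
Qed.

End Tree.

Section TreeTransform.
Context {R : realType} (B : completeNormedModType R) (M : nat).
Variables (c0 : B) (h : bool -> word -> 'I_4 -> B) (s : bool -> 'I_4 -> 'I_4).
Hypothesis s_inj : forall b, injective (s b).
Hypothesis h_anti : forall b u a, h b u (s b a) = - h b u a.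
Hypothesis h_inv : forall u a, h false u (s true a) = h false u a.

Let ns := nodes M.

(* The increments run through the nodes by nondecreasing depth, with two
   increments per node. *)
Definition tree_increments (k : nat) (x : M.-tuple 'I_4) : B :=
  if k is j.+1 then
    if (j./2 < size ns)%N then node_fun (h (odd j)) (nth [::] ns j./2) x else 0
  else c0.

(** The reflection acts at the node of index [k./2], and increments at earlier nodes do not notice
    it. The only earlier increment at the same node is the [false] piece when the [true] piece is
    reflected; [h_inv] treats this case. *)
Lemma symmetric_tree_increments : symmetric_increments tree_increments.
Proof.
move=> k; rewrite /tree_increments.
have [kns|_] := ltnP k./2 (size ns); last first.
  by exists id; split => // x; rewrite oppr0.
set u := nth [::] ns k./2.
have uM : (size u < M)%N by rewrite -(@mem_nodes M) mem_nth.
exists (act u (s (odd k))); split; first exact/act_inj/s_inj.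
- move=> [//|j] x jk.
  have jk2 : (j./2 <= k./2)%N by lia.
  rewrite (leq_ltn_trans jk2 kns).
  have [jk'|jk'] := eqVneq j./2 k./2.
    have [-> ->] : odd j = false /\ odd k = true by lia.
    rewrite jk' node_fun_act// /node_fun; case: ifP => // _; exact: h_inv.
  have /(pairwiseP [::]) := pairwise_nodes M.
  move=> /(_ j./2 k./2); rewrite !inE -/ns => /(_ (leq_ltn_trans jk2 kns) kns).
  rewrite ltn_neqAle jk' jk2 => /(_ isT)/andP[].
  by move=> ? ?; rewrite node_fun_act_lt.
- move=> x; rewrite node_fun_act// /node_fun; by case: ifP; rewrite ?oppr0.
Qed.

(** An index names a node, so a multiplier depending on the index alone becomes one depending on the
    prefix: predictable factors thus enter an inequality stated for deterministic ones. *)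
Lemma sum_tree_increments (e0 : R) (e : bool -> word -> R) (x : M.-tuple 'I_4) :
  \sum_(k < (size ns).*2.+1)
    (if nat_of_ord k is j.+1 then e (odd j) (nth [::] ns j./2) else e0)
      *: tree_increments k x =
  e0 *: c0 + \sum_(l < M)
    (e false (take l x) *: h false (take l x) (letter x l) +
     e true (take l x) *: h true (take l x) (letter x l)).
Proof.
rewrite big_ord_recl /=; congr (_ + _).
rewrite -(sum_nodes (fun u a => e false u *: h false u a + e true u *: h true u a))//.
rewrite (big_nth [::]) big_mkord.
pose F k := e (odd k) (nth [::] ns k./2) *: tree_increments k.+1 x.
rewrite (eq_bigr (fun k : 'I__ => F k))// sum_double /F.
apply: eq_bigr => i _; rewrite /tree_increments /= uphalf_double doubleK odd_double ltn_ord /=.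
rewrite /node_fun; case: ifP => // _; by rewrite !scaler0 addr0.
Qed.

End TreeTransform.

Lemma UMD_tree {R : realType} (B : completeNormedModType R) : UMD B ->
  exists p : R, 1 < p /\ exists C : R, 0 <= C /\
  forall (M : nat) (c0 : B) (h : bool -> word -> 'I_4 -> B)
    (s : bool -> 'I_4 -> 'I_4),
  (forall b, injective (s b)) ->
  (forall b u a, h b u (s b a) = - h b u a) ->
  (forall u a, h false u (s true a) = h false u a) ->
  forall (e0 : R) (e : bool -> word -> R),
  -1 <= e0 <= 1 -> (forall b u, -1 <= e b u <= 1) ->
  \sum_(x : M.-tuple 'I_4) `|e0 *: c0 + \sum_(l < M)
    (e false (take l x) *: h false (take l x) (letter x l) +
     e true (take l x) *: h true (take l x) (letter x l))| `^ p <=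
  C * \sum_(x : M.-tuple 'I_4) `|c0 + \sum_(l < M)
    (h false (take l x) (letter x l) + h true (take l x) (letter x l))| `^ p.
Proof.
move=> /UMD_symmetric[p [p1 [C [C0 umd]]]]; exists p; split=> //.
exists C; split=> // M c0 h s s_inj h_anti h_inv e0 e e01 e1.
have := umd _ [tuple ord0 | i < M] _
  (@symmetric_tree_increments _ _ M c0 _ _ s_inj h_anti h_inv)
  (fun k => if k is j.+1 then e (odd j) (nth [::] (nodes M) j./2) else e0) _
  (size (nodes M)).*2.
move=> /(_ ltac:(by case)).
under eq_bigr do rewrite sum_tree_increments.
rewrite [X in _ * X](_ : _ = \sum_(x : M.-tuple 'I_4) `|c0 + \sum_(l < M)
    (h false (take l x) (letter x l) + h true (take l x) (letter x l))| `^ p)//.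
apply: eq_bigr => x _; congr (`|_| `^ p).
(* The untransformed sum is the same identity with all multipliers 1. *)
have := sum_tree_increments c0 h 1 (fun _ _ => 1) x.
rewrite scale1r; under [in X in _ = X -> _]eq_bigr do rewrite !scale1r.
move=> <-; apply: eq_bigr => k _; case: (nat_of_ord k) => [|j]; by rewrite scale1r.
Qed.

(** * Stopping on the tree *)

Notation q0 := (@Ordinal 4 0 isT).
Notation q1 := (@Ordinal 4 1 isT).
Notation q2 := (@Ordinal 4 2 isT).
Notation q3 := (@Ordinal 4 3 isT).

Lemma ord4P (P : 'I_4 -> Prop) : P q0 -> P q1 -> P q2 -> P q3 -> forall a, P a.
Proof.
move=> P0 P1 P2 P3 [[|[|[|[|//]]]] a4].
- by rewrite (_ : Ordinal a4 = q0)//; exact: val_inj.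
- by rewrite (_ : Ordinal a4 = q1)//; exact: val_inj.
- by rewrite (_ : Ordinal a4 = q2)//; exact: val_inj.
- by rewrite (_ : Ordinal a4 = q3)//; exact: val_inj.
Qed.

Lemma big_ord4 (V : nmodType) (f : 'I_4 -> V) :
  \sum_a f a = f q0 + f q1 + f q2 + f q3.
Proof.
rewrite !big_ord_recr big_ord0 /=.
by rewrite add0r; congr (f _ + f _ + f _ + f _); exact: val_inj.
Qed.

Definition vec4 (V : Type) (w x y z : V) (a : 'I_4) : V := nth w [:: w; x; y; z] a.

Section Profiles.
Context {R : realType}.

Definition phiq : 'I_4 -> R := vec4 (-1) 1 1 (-1).
Definition psiq : 'I_4 -> R := vec4 7 (-1) 1 (-7).

(* phiq = oddq false + oddq true = halfq false + halfq true, while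
   psiq = 3 (oddq false - oddq true) + 4 (halfq true - halfq false). *)
Definition oddq (b : bool) : 'I_4 -> R :=
  if b then vec4 (-1) 0 1 0 else vec4 0 1 0 (-1).
Definition halfq (b : bool) : 'I_4 -> R :=
  if b then vec4 0 0 1 (-1) else vec4 (-1) 1 0 0.

End Profiles.

(** Exchanges the two quarters where [oddq b] is nonzero, which reverses that piece, and fixes the
    two quarters that carry the other piece. [half_swap] does the same for [halfq]. *)
Definition odd_swap (b : bool) : 'I_4 -> 'I_4 :=
  if b then vec4 q2 q1 q0 q3 else vec4 q0 q3 q2 q1.
Definition half_swap (b : bool) : 'I_4 -> 'I_4 :=
  if b then vec4 q0 q1 q3 q2 else vec4 q1 q0 q2 q3.
(** For [false] this changes the sign of phi; for [true] it is the reversal of the quarters, which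
    preserves phi. *)
Definition phi_swap (b : bool) : 'I_4 -> 'I_4 :=
  if b then vec4 q3 q2 q1 q0 else vec4 q1 q0 q3 q2.

Lemma inj4 (s : 'I_4 -> 'I_4) :
  [&& s q0 != s q1, s q0 != s q2, s q0 != s q3, s q1 != s q2,
      s q1 != s q3 & s q2 != s q3] -> injective s.
Proof.
move=> /and5P[/eqP ? /eqP ? /eqP ? /eqP ? /andP[/eqP ? /eqP ?]].
by elim/ord4P; elim/ord4P => // /esym.
Qed.

Section Stopping.
Context {R : realType} (M : nat) (T : pred word).
Hypothesis T_take : forall u i, T u -> T (take i u).
Implicit Types (x : M.-tuple 'I_4).

(** [find] returns M when all proper prefixes satisfy [T]; the full word itself is never tested. *)
Definition stop_time x : nat := find (fun i => ~~ T (take i x)) (iota 0 M).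

Lemma stop_time_le x : (stop_time x <= M)%N.
Proof. by rewrite (leq_trans (find_size _ _))// size_iota. Qed.

Lemma before_stop x i : (i < stop_time x)%N -> T (take i x).
Proof.
move=> ix; have := before_find 0%N ix; rewrite nth_iota ?add0n.
  by move/negbFE.
exact: leq_trans ix (stop_time_le x).
Qed.

Lemma at_stop x : (stop_time x < M)%N -> ~~ T (take (stop_time x) x).
Proof.
move=> xM; have := @nth_find _ 0%N (fun i => ~~ T (take i x)) (iota 0 M).
by rewrite has_find size_iota nth_iota// add0n; apply.
Qed.

(** Stopping as a predictable transform: each increment carries the indicator of [T] at its node,
    the form to which the tree inequality applies. *)
Definition stopped (V : zmodType) (H : word -> V) x : V :=
  H [::] + \sum_(l < M)
    (if T (take l x) then H (take l.+1 x) - H (take l x) else 0).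

(** Since [T] is closed under prefixes, it holds on the tested prefixes exactly before the stopping
    time, and the sum telescopes. *)
Lemma stoppedE (V : zmodType) (H : word -> V) x :
  stopped H x = H (take (stop_time x) x).
Proof.
rewrite /stopped -(big_mkord predT (fun l =>
  if T (take l x) then H (take l.+1 x) - H (take l x) else 0)).
rewrite (big_cat_nat (n := stop_time x)) ?stop_time_le//=.
rewrite [X in _ + (_ + X)]big_nat_cond [X in _ + (_ + X)]big1; last first.
  move=> i /andP[/andP[xi iM] _]; case: ifP => // Ti.
  have := at_stop (leq_ltn_trans xi iM).
  by have := T_take (stop_time x) Ti; rewrite take_takel// => ->.
rewrite addr0 big_nat_cond (eq_bigr (fun l => H (take l.+1 x) - H (take l x))).
  by rewrite -big_nat_cond telescope_sumr// take0 addrC subrK.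
by move=> i /andP[/andP[_ /before_stop ->]].
Qed.

(** Translating the letter after [u] by c permutes the words. Averaging over the four values of c
    replaces [D u] by its mean over all letters, which is 0. *)
Lemma sum_letter_zero (D : word -> 'I_4 -> R) l : (l < M)%N ->
  (forall u, \sum_a D u a = 0) ->
  \sum_(x : M.-tuple 'I_4) D (take l x) (letter x l) = 0.
Proof.
move=> lM D0.
have node0 u : size u = l -> \sum_(x : M.-tuple 'I_4) node_fun D u x = 0.
  move=> ul; set S := LHS.
  have shift c : S = \sum_(x : M.-tuple 'I_4) node_fun (fun v a => D v (a + c)) u x.
    rewrite /S (reindex_inj (@act_inj M u _ (addIr c))).
    by apply: eq_bigr => x _; rewrite node_fun_act// ul.
  have : \sum_(c : 'I_4) S = 0.
    rewrite (eq_bigr _ (fun c _ => shift c)) exchange_big /=; apply: big1 => x _.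
    rewrite /node_fun; case: (_ == u); last by rewrite big1.
    transitivity (\sum_b D u b); last exact: D0.
    by rewrite [RHS](reindex_inj (addrI (letter x (size u)))).
  rewrite sumr_const card_ord => /eqP; rewrite mulrn_eq0 /= => /eqP //.
transitivity (\sum_(x : M.-tuple 'I_4) \sum_(u <- words l) node_fun D u x).
  apply: eq_bigr => x _.
  have sl : size (take l x) = l by rewrite size_take size_tuple lM.
  rewrite (bigD1_seq (take l x)) ?uniq_words ?mem_words ?sl//=.
  rewrite /node_fun sl eqxx big_seq_cond big1 ?addr0// => u.
  rewrite mem_words => /andP[/eqP -> ux]; by rewrite eq_sym (negbTE ux).
rewrite exchange_big big_seq big1// => u; rewrite mem_words => /eqP; exact: node0.
Qed.

Lemma take_letter x l : (l < M)%N -> take l.+1 x = rcons (take l x) (letter x l).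
Proof. by move=> lM; rewrite -take_nth// size_tuple. Qed.

(** Optional stopping: the increments of [a] sum to zero at every node, also after those beyond the
    stopping time are erased. The factor [4 ^+ M] counts the words. *)
Lemma sum_stopped (a : word -> R) :
  (forall u, a u = 4^-1 * \sum_b a (rcons u b)) ->
  \sum_(x : M.-tuple 'I_4) stopped a x = 4 ^+ M * a [::].
Proof.
move=> aE; rewrite big_split /= sumr_const card_tuple card_ord exchange_big /=.
rewrite [X in _ + X]big1 ?addr0 => [|l _].
  by rewrite -[LHS]mulr_natl natrX.
rewrite -[RHS](@sum_letter_zero
  (fun u b => if T u then a (rcons u b) - a u else 0) l)// => [|u].
  by apply: eq_bigr => x _; rewrite take_letter.
case: (T u); last by rewrite big1.
by rewrite sumrB sumr_const card_ord -[X in _ - X]mulr_natl [in X in _ - X]aE mulVKf ?subrr.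
Qed.

End Stopping.

(** * The phi-coefficients and the psi-sums on the tree *)

Section TreeOperator.
Context {R : realType} {B : completeNormedModType R}.
Implicit Types (F : word -> B) (u : word).

(** When [F] gives the averages of f, this is |I|^(-1/2) <f, phi_I>. *)
Definition phi_coef F u : B := 4^-1 *: \sum_a phiq a *: F (rcons u a).

(** The value on the cell of [u] of the sum of gamma(I) <f, phi_I> psi_I over the proper ancestors I
    of [u]; the factor |I|^(-1/2) of psi_I sits in [phi_coef]. *)
Definition shift_fun F (gamma : word -> R) u : B :=
  \sum_(l < size u) (gamma (take l u) * psiq (letter u l)) *: phi_coef F (take l u).

Lemma shift_fun_rcons F gamma u a : shift_fun F gamma (rcons u a) =
  shift_fun F gamma u + (gamma u * psiq a) *: phi_coef F u.
Proof.
rewrite /shift_fun size_rcons big_ord_recr /=; congr (_ + _).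
  apply: eq_bigr => l _; rewrite nth_rcons ltn_ord.
  by rewrite -cats1 takel_cat// ltnW.
by rewrite nth_rcons ltnn eqxx -cats1 take_size_cat.
Qed.

(** The increment is split into even and odd parts under reversal of the quarters. The even part has
    mean zero, hence is a multiple of phi; the odd part is half the difference of mirror values. *)
Lemma phi_decomp F u a : F u = 4^-1 *: \sum_b F (rcons u b) ->
  F (rcons u a) - F u = phiq a *: phi_coef F u +
    2^-1 *: (F (rcons u a) - F (rcons u (phi_swap true a))).
Proof.
move=> Fu; rewrite /phi_coef Fu !big_ord4 /phiq /vec4 /=.
rewrite !scaleN1r !scale1r.
have mid (y z : B) : y - 2^-1 *: (y + z) = 2^-1 *: (y - z).
  rewrite scalerDr opprD addrA -{1}[y]scale1r -scalerBl scalerBr.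
  by congr (_ *: _ - _); lra.
have half (y z : B) : 4^-1 *: y + 4^-1 *: z = 2^-1 *: (2^-1 *: (y + z)).
  by rewrite -scalerDr scalerA; congr (_ *: _); field.
have avg (y z : B) : 2^-1 *: ((y + z) + (y - z)) = y.
  rewrite addrACA subrr addr0 -mulr2n -[X in _ *: X]scaler_nat scalerA mulVf ?scale1r//.
set y0 := F (rcons u q0); set y1 := F (rcons u q1).
set y2 := F (rcons u q2); set y3 := F (rcons u q3).
have S03 : y0 + y1 + y2 + y3 = (y0 + y3) + (y1 + y2).
  by rewrite -[in LHS]addrA [y2 + y3]addrC addrACA.
have V03 : - y0 + y1 + y2 - y3 = (y1 + y2) - (y0 + y3).
  by rewrite opprD -[in LHS]addrA [- y0 + y1]addrC [in LHS]addrACA.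
have outer : 4^-1 *: (y0 + y1 + y2 + y3) - 4^-1 *: (- y0 + y1 + y2 - y3)
    = 2^-1 *: (y0 + y3).
  rewrite -scalerN half V03 S03 opprB avg//.
have inner : 4^-1 *: (y0 + y1 + y2 + y3) + 4^-1 *: (- y0 + y1 + y2 - y3)
    = 2^-1 *: (y1 + y2).
  by rewrite half V03 S03 [y0 + y3 + _]addrC avg.
have solve (y m v d : B) : y - (m + v) = d -> y - m = v + d.
  by move=> <-; rewrite opprD [y + (_ + _)]addrA [RHS]addrC subrK.
elim/ord4P : a; rewrite /phi_swap /= -/y0 -/y1 -/y2 -/y3;
  rewrite ?scaleN1r ?scale1r; apply: solve; rewrite ?outer ?inner -?mid//.
- by rewrite [y1 + _]addrC.
- by rewrite [y0 + _]addrC.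
Qed.

End TreeOperator.

(** * The weak type inequality on the tree *)

Section TreeBounds.
Context {R : realType} {B : completeNormedModType R}.
Implicit Types (F : word -> B) (u : word).

Lemma UMD_stopped : UMD B -> exists p : R, 1 < p /\ exists C : R, 0 <= C /\
  forall (M : nat) (T : pred word) (F : word -> B) (gamma : word -> R),
  (forall u, F u = 4^-1 *: \sum_a F (rcons u a)) ->
  (forall u, `|gamma u| <= 1) ->
  \sum_(x : M.-tuple 'I_4) `|stopped T (shift_fun F gamma) x| `^ p <=
  C * \sum_(x : M.-tuple 'I_4) `|stopped T F x| `^ p.
Proof.
move=> /UMD_tree[p [p1 [C [C0 umd]]]]; exists p; split=> //.
(* [X] and [Y] below each cost two applications of the tree inequality, hence [C * C]; 7 = 3 + 4
   comes from the coefficients of psi. *)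
exists (7 `^ p * (C * C + C * C)); split.
  by rewrite mulr_ge0 ?powR_ge0// addr_ge0// mulr_ge0.
move=> M T F gamma Fu gamma1.
have p0 : 0 <= p by rewrite ltW// (lt_trans _ p1).
pose W u : B := if T u then gamma u *: phi_coef F u else 0.
have s1 : forall b, injective (phi_swap b) by case; exact: inj4.
have s2 : forall b, injective (odd_swap b) by case; exact: inj4.
have s3 : forall b, injective (half_swap b) by case; exact: inj4.
(* The complement of the phi-component is odd under the reversal of the
   quarters, which preserves phi. *)
have step1 : \sum_(x : M.-tuple 'I_4) `|\sum_(l < M)
      phiq (letter x l) *: W (take l x)| `^ p <=
    C * \sum_(x : M.-tuple 'I_4) `|stopped T F x| `^ p.
  pose h (b : bool) u a : B := if T u then
    (if b then 2^-1 *: (F (rcons u a) - F (rcons u (phi_swap true a)))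
     else phiq a *: phi_coef F u) else 0.
  have anti b u a : h b u (phi_swap b a) = - h b u a.
    rewrite /h; case: (T u); last by rewrite oppr0.
    case: b; first by rewrite -scalerN opprB; elim/ord4P: a.
    by rewrite -scaleNr; congr (_ *: _); elim/ord4P: a; rewrite /phiq /vec4/= ?opprK.
  have inv u a : h false u (phi_swap true a) = h false u a.
    by rewrite /h; case: (T u) => //; congr (_ *: _); elim/ord4P: a.
  (* The multiplier 0 erases the odd part, and [e0] likewise the initial value [F [::]]; the
     phi-component receives [gamma u]. *)
  have e1 (b : bool) u : -1 <= (if b then 0 else gamma u) <= 1.
    by case: b; [apply/andP; split; lra | by rewrite -ler_norml].
  have e0 : -1 <= (0 : R) <= 1 by apply/andP; split; lra.
  have := umd M (F [::]) h phi_swap s1 anti inv 0 _ e0 e1.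
  rewrite [leLHS](eq_bigr (fun x : M.-tuple 'I_4 => `|\sum_(l < M)
      phiq (letter x l) *: W (take l x)| `^ p)) => [|x _].
    move=> /le_trans; apply; apply: ler_wpM2l => //.
    apply: ler_sum => x _; rewrite le_eqVlt; apply/orP; left; apply/eqP.
    congr (`|_ + _| `^ p); apply: eq_bigr => l _; rewrite /h.
    case: ifP => _; last by rewrite addr0.
    by rewrite take_letter// [RHS]phi_decomp.
  rewrite scale0r add0r; congr (`|_| `^ p); apply: eq_bigr => l _.
  rewrite /h /W; case: ifP => _; rewrite ?scaler0 ?addr0// scale0r addr0.
  by move: (phi_coef F _) => v; rewrite !scalerA mulrC.
(* The two ways of splitting phi into conditionally symmetric pieces. *)
have step2 (c : bool -> 'I_4 -> R) (s : bool -> 'I_4 -> 'I_4) :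
    (forall b, injective (s b)) -> (forall b a, c b (s b a) = - c b a) ->
    (forall a, c false (s true a) = c false a) ->
    (forall a, c false a + c true a = phiq a) ->
    \sum_(x : M.-tuple 'I_4) `|\sum_(l < M)
      (c false (letter x l) - c true (letter x l)) *: W (take l x)| `^ p <=
    C * C * \sum_(x : M.-tuple 'I_4) `|stopped T F x| `^ p.
  move=> sinj anti inv cE.
  have e1 (b : bool) u : -1 <= (if b then -1 else 1 : R) <= 1.
    by case: b; apply/andP; split; lra.
  have e0 : -1 <= (0 : R) <= 1 by apply/andP; split; lra.
  have := umd M 0 (fun b u a => c b a *: W u) s sinj _ _ 0 _ e0 e1.
  rewrite -mulrA; set L := (X in _ -> _ -> X <= _); set K := (X in _ -> _ -> _ <= _ * X).
  have -> : L = \sum_(x : M.-tuple 'I_4) `|\sum_(l < M)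
      (c false (letter x l) - c true (letter x l)) *: W (take l x)| `^ p.
    apply: eq_bigr => x _; rewrite scaler0 add0r; congr (`|_| `^ p).
    by apply: eq_bigr => l _; rewrite scale1r scaleN1r scalerBl.
  have -> : K = \sum_(x : M.-tuple 'I_4) `|\sum_(l < M)
      phiq (letter x l) *: W (take l x)| `^ p.
    apply: eq_bigr => x _; rewrite add0r; congr (`|_| `^ p).
    by apply: eq_bigr => l _; rewrite -scalerDl cE.
  move=> H; apply: (le_trans (H _ _)).
  - by move=> b u a; rewrite anti scaleNr.
  - by move=> u a; rewrite inv.
  - exact: ler_wpM2l.
have X1 := step2 oddq odd_swap s2.
have Y1 := step2 halfq half_swap s3.
set X := fun x : M.-tuple 'I_4 => \sum_(l < M)
  (oddq false (letter x l) - oddq true (letter x l)) *: W (take l x).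
set Y := fun x : M.-tuple 'I_4 => \sum_(l < M)
  (halfq false (letter x l) - halfq true (letter x l)) *: W (take l x).
have {}X1 : \sum_x `|X x| `^ p <=
    C * C * \sum_(x : M.-tuple 'I_4) `|stopped T F x| `^ p.
  apply: X1.
  - by case; elim/ord4P; rewrite /oddq /odd_swap /vec4 /= ?opprK ?oppr0.
  - by elim/ord4P.
  - by elim/ord4P; rewrite /oddq /phiq /vec4 /= ?addr0 ?add0r.
have {}Y1 : \sum_x `|Y x| `^ p <=
    C * C * \sum_(x : M.-tuple 'I_4) `|stopped T F x| `^ p.
  apply: Y1.
  - by case; elim/ord4P; rewrite /halfq /half_swap /vec4 /= ?opprK ?oppr0.
  - by elim/ord4P.
  - by elim/ord4P; rewrite /halfq /phiq /vec4 /= ?addr0 ?add0r.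
have XY x : stopped T (shift_fun F gamma) x = 3 *: X x - 4 *: Y x.
  rewrite /stopped [shift_fun _ _ [::]]big_ord0 add0r /X /Y !scaler_sumr -sumrB.
  apply: eq_bigr => l _; rewrite take_letter// shift_fun_rcons addrC addKr /W.
  case: ifP => _; last by rewrite !scaler0 subr0.
  rewrite !scalerA -scalerBl; congr (_ *: _).
  elim/ord4P: (letter x l); rewrite /psiq /oddq /halfq /vec4 /=; ring.
apply: (@le_trans _ _ (7 `^ p * (\sum_x `|X x| `^ p + \sum_x `|Y x| `^ p))).
  rewrite -big_split mulr_sumr; apply: ler_sum => x _ /=; rewrite XY.
  apply: (@le_trans _ _ ((7 * Num.max `|X x| `|Y x|) `^ p)).
    apply: ge0_ler_powR => //; rewrite ?nnegrE// ?mulr_ge0// ?le_max ?normr_ge0//.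
    rewrite (le_trans (ler_normB _ _))// !normrZ !ger0_norm//.
    have mX : `|X x| <= Num.max `|X x| `|Y x| by rewrite le_max lexx.
    have mY : `|Y x| <= Num.max `|X x| `|Y x| by rewrite le_max lexx orbT.
    lra.
  rewrite powRM// ?le_max ?normr_ge0//; apply: ler_wpM2l; first exact: powR_ge0.
  by rewrite maxEle; case: ifP => _; rewrite ?lerDl ?lerDr powR_ge0.
rewrite -mulrA; apply: ler_wpM2l; first exact: powR_ge0.
by rewrite mulrDl lerD.
Qed.

(** In the constant, 1 stems from Markov's inequality for the stopped [a], and C 4^(p-1) from the
    L_p bound: the p-th power of the stopped [F] is at most (4 lam)^(p-1) times the stopped [a],
    whose total is known by [sum_stopped]. *)
Lemma weak_type_tree : UMD B -> exists C : R, 0 <= C /\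
  forall (M : nat) (F : word -> B) (a : word -> R) (gamma : word -> R) (lam : R),
  (forall u, F u = 4^-1 *: \sum_b F (rcons u b)) ->
  (forall u, a u = 4^-1 * \sum_b a (rcons u b)) ->
  (forall u, `|F u| <= a u) -> (forall u, `|gamma u| <= 1) -> 0 < lam ->
  lam * #|[pred x : M.-tuple 'I_4 |
    [exists m : 'I_M.+1, lam <= `|shift_fun F gamma (take m x)|]]|%:R <=
  C * (4 ^+ M * a [::]).
Proof.
move=> /UMD_stopped[p [p1 [C [C0 umd]]]].
exists (1 + C * 4 `^ (p - 1)); split; first by rewrite addr_ge0 ?mulr_ge0 ?powR_ge0.
move=> M F a gamma lam Fu au Fa gamma1 lam0.
have p0 : 0 < p by rewrite (lt_trans _ p1).
have a0 u : 0 <= a u by rewrite (le_trans _ (Fa u)).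
set bad := [pred x | _].
have Ma0 : 0 <= 4 ^+ M * a [::] by rewrite mulr_ge0.
(* When the first average already exceeds [lam], counting all words suffices; otherwise [a [::] <=
   lam] covers stopping at time 0. *)
have [alam|alam] := ltP lam (a [::]).
  apply: (@le_trans _ _ (4 ^+ M * a [::])).
    rewrite mulrC; apply: ler_pM; rewrite ?ler0n ?(ltW lam0) ?(ltW alam)//.
    rewrite (_ : 4 ^+ M = (4 ^ M)%:R :> R); last by rewrite natrX.
    by rewrite ler_nat (leq_trans (max_card _))// card_tuple card_ord.
  by rewrite ler_peMl// lerDl mulr_ge0 ?powR_ge0.
pose ok u := (a u <= lam) && (`|shift_fun F gamma u| < lam).
(* Testing all prefixes makes [T] closed under prefixes, as [stoppedE] requires. *)
pose T u := all (fun i => ok (take i u)) (iota 0 (size u).+1).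
have TP u : reflect (forall i, (i <= size u)%N -> ok (take i u)) (T u).
  apply: (iffP allP) => H i.
    by move=> iu; apply: H; rewrite mem_iota add0n.
  by rewrite mem_iota add0n => /andP[_ iu]; apply: H.
have T_ok u : T u -> ok u by move=> /TP /(_ _ (leqnn _)); rewrite take_size.
have T_take u i : T u -> T (take i u).
  move=> /TP Tu; apply/TP => j; rewrite size_take_min => ji.
  by rewrite take_takel; [apply: Tu|]; lia.
(* The parent of the stopping node has average at most [lam], and its four children have nonnegative
   averages with sum at most 4 lam. *)
have sta (x : M.-tuple 'I_4) : 0 <= stopped T a x <= 4 * lam.
  rewrite stoppedE// a0 /=; case tx : (stop_time T x) => [|t].
    by rewrite take0 (le_trans alam)// ler_peMl// ?ltW//; lra.
  have /T_ok/andP[+ _] : T (take t x) by apply: (@before_stop M T); rewrite tx.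
  have tM : (t < M)%N by rewrite -tx stop_time_le.
  rewrite au big_ord4 take_letter// => abound.
  have := a0 (rcons (take t x) q0); have := a0 (rcons (take t x) q1).
  have := a0 (rcons (take t x) q2); have := a0 (rcons (take t x) q3).
  elim/ord4P: (letter x t); lra.
have bad_stopped (x : M.-tuple 'I_4) : x \in bad ->
    lam <= stopped T a x \/ lam <= `|stopped T (shift_fun F gamma) x|.
  rewrite inE => /existsP[[m mM] /= xm]; rewrite !stoppedE//.
  have tm : (stop_time T x <= m)%N.
    rewrite leqNgt; apply/negP => /before_stop /T_ok /andP[_].
    by rewrite ltNge xm.
  (* If the time is M, then m = M and the partial sum is large at the full word, which the stopping
     time does not test. *)
  have [tM|Mt] := ltnP (stop_time T x) M; last first.
    by right; rewrite (_ : stop_time T x = m)//; lia.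
  have st : size (take (stop_time T x) x) = stop_time T x.
    by rewrite size_take size_tuple tM.
  have : ~~ ok (take (stop_time T x) x).
    apply: contra (at_stop tM) => okt; apply/TP => i; rewrite st leq_eqVlt.
    case/predU1P => [->|it]; first by rewrite take_takel.
    by rewrite take_takel 1?ltnW//; apply/T_ok/(@before_stop M T).
  by rewrite negb_and -ltNge -leNgt => /orP[/ltW|]; [left|right].
have st_sum : \sum_(x : M.-tuple 'I_4) stopped T a x = 4 ^+ M * a [::].
  exact: sum_stopped.
have st_F : \sum_(x : M.-tuple 'I_4) `|stopped T F x| `^ p <=
    (4 * lam) `^ (p - 1) * (4 ^+ M * a [::]).
  rewrite -st_sum mulr_sumr; apply: ler_sum => x _.
  have /andP[sa0 sa4] := sta x.
  apply: (@le_trans _ _ (stopped T a x `^ p)).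
    by apply: ge0_ler_powR; rewrite ?nnegrE ?(ltW p0) ?normr_ge0//= !stoppedE.
  have [->|sa] := eqVneq (stopped T a x) 0.
    by rewrite powR0 ?gt_eqF// mulr0.
  rewrite [leLHS](_ : _ = stopped T a x `^ (p - 1) * stopped T a x); last first.
    by rewrite -[X in _ * X](powRr1 sa0) -powRD ?subrK// sa implybT.
  apply: ler_wpM2r => //.
  apply: ge0_ler_powR => //; rewrite ?nnegrE// ?subr_ge0 ?(ltW p1)//.
  by rewrite mulr_ge0// ltW.
have lamp : 0 < lam `^ p by rewrite powR_gt0.
(* The weight is lam^(1-p), so a word whose stopped partial sum is large contributes at least [lam]
   to the second term. *)
have count : lam * #|bad|%:R <= \sum_(x : M.-tuple 'I_4)
    (stopped T a x + lam / lam `^ p * `|stopped T (shift_fun F gamma) x| `^ p).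
  rewrite -sum1_card natr_sum mulr_sumr big_mkcond /=.
  apply: ler_sum => x _; have /andP[sa0 _] := sta x.
  have g0 : 0 <= lam / lam `^ p * `|stopped T (shift_fun F gamma) x| `^ p.
    by rewrite mulr_ge0 ?powR_ge0// divr_ge0 ?powR_ge0// ltW.
  case: ifP => [/bad_stopped|_]; last by rewrite addr_ge0.
  rewrite mulr1; case=> [sl|gl]; first by rewrite (le_trans sl)// lerDl.
  apply: (@le_trans _ _ (lam / lam `^ p * `|stopped T (shift_fun F gamma) x| `^ p));
    last by rewrite lerDr.
  rewrite -mulrA ler_peMr ?(ltW lam0)// mulrC ler_pdivlMr// mul1r.
  by apply: ge0_ler_powR; rewrite ?nnegrE ?(ltW p0) ?(ltW lam0) ?normr_ge0.
apply: (le_trans count); rewrite big_split /= st_sum -mulr_sumr mulrDl mul1r lerD2l.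
apply: (@le_trans _ _ (lam / lam `^ p * (C * ((4 * lam) `^ (p - 1) * (4 ^+ M * a [::]))))).
  apply: ler_wpM2l; first by rewrite divr_ge0 ?powR_ge0// ltW.
  by apply: (le_trans (umd M T F gamma Fu gamma1)); apply: ler_wpM2l.
rewrite powRM ?(ltW lam0)//; set c4 := 4 `^ _; set X := 4 ^+ M * _.
have lp : lam `^ p = lam `^ (p - 1) * lam.
  rewrite -[X in _ * X](powRr1 (ltW lam0)) -powRD ?subrK//.
  by rewrite gt_eqF ?implybT.
have lp1 : lam `^ (p - 1) != 0 by rewrite gt_eqF// powR_gt0.
rewrite le_eqVlt; apply/orP; left; apply/eqP; rewrite lp; field.
by rewrite lp1 gt_eqF.
Qed.

End TreeBounds.

(** * Bochner integrals *)

Section BochnerTheory.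
Context {R : realType} {B : completeNormedModType R}.
Context {d} {T : measurableType d} (mu : {measure set T -> \bar R}).
Implicit Types (A D E : set T) (s : seq (set T * B)) (h : T -> B) (v w : B).

Definition measurable_seq s := forall p, p \in s -> measurable p.1.
Definition finite_sets_seq D s :=
  forall p, p \in s -> measurable p.1 /\ (mu (p.1 `&` D) < +oo)%E.
Definition sint D s : B := \sum_(p <- s) fine (mu (p.1 `&` D)) *: p.2.
Definition scale_seq (a : R) s := [seq (p.1, a *: p.2) | p <- s].

Lemma finite_sets_seq_measurable D s : finite_sets_seq D s -> measurable_seq s.
Proof. by move=> fs p /fs[]. Qed.

Lemma sfun_eval_nil x : @sfun_eval R B T [::] x = 0.
Proof. by rewrite /sfun_eval big_nil. Qed.

Lemma sfun_eval_cons p s x :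
  sfun_eval (p :: s) x = (\1_(p.1) x : R) *: p.2 + sfun_eval s x.
Proof. by rewrite /sfun_eval big_cons. Qed.

Lemma sfun_eval_cat s s' x : sfun_eval (s ++ s') x = sfun_eval s x + sfun_eval s' x.
Proof. by rewrite /sfun_eval big_cat. Qed.

Lemma sfun_eval_scale a s x : sfun_eval (scale_seq a s) x = a *: sfun_eval s x.
Proof.
rewrite /sfun_eval big_map scaler_sumr.
by apply: eq_bigr => p _ /=; rewrite !scalerA mulrC.
Qed.

Lemma sint_cat D s s' : sint D (s ++ s') = sint D s + sint D s'.
Proof. by rewrite /sint big_cat. Qed.

Lemma sint_scale D a s : sint D (scale_seq a s) = a *: sint D s.
Proof.
rewrite /sint big_map scaler_sumr.
by apply: eq_bigr => p _ /=; rewrite !scalerA mulrC.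
Qed.

Lemma finite_sets_seq_cat D s s' :
  finite_sets_seq D s -> finite_sets_seq D s' -> finite_sets_seq D (s ++ s').
Proof. by move=> fs fs' p; rewrite mem_cat => /orP[/fs|/fs']. Qed.

Lemma finite_sets_seq_scale D a s : finite_sets_seq D s -> finite_sets_seq D (scale_seq a s).
Proof. by move=> fs p /mapP[q /fs fq ->]. Qed.

(** On the first set its value moves into the constant, which is why the induction carries [c]. Only
    real functions are handled, so no sigma-algebra on B is involved. *)
Lemma measurable_norm_sfun (s : seq (set T * B)) (c : B) D :
  measurable_seq s -> measurable_fun D (fun x => `|c + sfun_eval s x|).
Proof.
move=> ms; apply: measurable_funTS; elim: s ms c => [|p s ih] ms c.
  by under eq_fun do rewrite sfun_eval_nil; exact: measurable_cst.
have mp : measurable p.1 by apply: ms; rewrite mem_head.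
have {}ih := ih (fun q qs => ms q (@mem_behead _ (p :: s) _ qs)).
rewrite (_ : (fun x => _) = (fun x => \1_(p.1) x * `|(c + p.2) + sfun_eval s x| +
    \1_(~` p.1) x * `|c + sfun_eval s x|)).
  apply: measurable_funD; apply: measurable_funM => //; apply: measurable_indic => //.
  exact: measurableC.
apply/funext => x; rewrite sfun_eval_cons !indicE in_setC.
by case: (x \in p.1); rewrite /= ?scale1r ?scale0r ?mul1r ?mul0r ?add0r ?addr0 ?addrA.
Qed.

Lemma measurable_norm_sub_sfun s s' D : measurable_seq s -> measurable_seq s' ->
  measurable_fun D (fun x => `|sfun_eval s x - sfun_eval s' x|).
Proof.
move=> ms ms'.
rewrite (_ : (fun _ => _) = fun x => `|0 + sfun_eval (s ++ scale_seq (-1) s') x|).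
  apply: measurable_norm_sfun => p; rewrite mem_cat => /orP[/ms//|].
  by move=> /mapP[q /ms' mq ->].
by apply/funext => x; rewrite add0r sfun_eval_cat sfun_eval_scale scaleN1r.
Qed.

Lemma fine_measureDI E A : measurable E -> measurable A -> (mu E < +oo)%E ->
  fine (mu E) = fine (mu (E `&` A)) + fine (mu (E `\` A)).
Proof.
move=> mE mA Efin; have fin (C : set T) : measurable C -> C `<=` E -> mu C \is a fin_num.
  by move=> mC CE; rewrite ge0_fin_numE// (le_lt_trans _ Efin)// le_measure ?inE.
rewrite (measureDI mu mE mA) fineD; first exact: addrC.
  by apply: fin => //; exact: measurableD.
by apply: fin => //; exact: measurableI.
Qed.

(* Splitting E along the first set of the list reduces to a constant c
   without ever passing to a disjoint representation. *)
Lemma norm_sint_le_add s E c : measurable E -> finite_sets_seq E s ->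
  (mu E < +oo)%E \/ c = 0 ->
  (`|sint E s + fine (mu E) *: c|%:E <= \int[mu]_(x in E) `|c + sfun_eval s x|%:E)%E.
Proof.
elim: s E c => [|p s ih] E c mE fs Ec.
  rewrite /sint big_nil add0r; under eq_integral do rewrite sfun_eval_nil addr0.
  case: Ec => [Efin|->]; last first.
    by rewrite scaler0 normr0 integral_ge0.
  rewrite (integral_cst _ mE) normrZ ger0_norm ?fine_ge0//.
  by rewrite EFinM fineK ?ge0_fin_numE// muleC.
have [mp pfin] : measurable p.1 /\ (mu (p.1 `&` E) < +oo)%E.
  by apply: fs; rewrite mem_head.
have ms : finite_sets_seq E s by move=> q qs; apply: fs; rewrite inE qs orbT.
have sub A q : measurable A -> A `<=` E -> q \in s ->
    measurable q.1 /\ (mu (q.1 `&` A) < +oo)%E.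
  move=> mA AE /ms[mq qfin]; split=> //; rewrite (le_lt_trans _ qfin)//.
  by rewrite le_measure ?inE//; [exact: measurableI|exact: measurableI|exact: setIS].
have mI : measurable (E `&` p.1) by exact: measurableI.
have mD : measurable (E `\` p.1) by exact: measurableD.
have E1fin : (mu (E `&` p.1) < +oo)%E by rewrite setIC.
have E1 := ih (E `&` p.1) (c + p.2) mI (fun q => sub _ q mI (@subIsetl _ _ _))
  (or_introl E1fin).
(* Outside [p.1] the constant is unchanged, and infinite measure is allowed only when it is 0. *)
have Ec2 : (mu (E `\` p.1) < +oo)%E \/ c = 0.
  case: Ec => [Efin|]; [left|by right].
  by rewrite (le_lt_trans _ Efin)// le_measure ?inE.
have E2 := ih (E `\` p.1) c mD (fun q => sub _ q mD (@subDsetl _ _ _)) Ec2.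
have mps : measurable_seq (p :: s).
  by move=> q; rewrite inE => /predU1P[->//|/ms[]].
rewrite -[in leRHS](setUIDK E p.1) ge0_integral_setU//; last first.
- by apply/disj_set2P; rewrite setDE setIACA setICr setI0.
- by rewrite setUIDK; exact/measurable_EFinP/measurable_norm_sfun.
have I1 : (\int[mu]_(x in E `&` p.1) `|c + sfun_eval (p :: s) x|%:E =
    \int[mu]_(x in E `&` p.1) `|c + p.2 + sfun_eval s x|%:E)%E.
  apply: eq_integral => x; rewrite inE => -[_ px].
  by rewrite sfun_eval_cons indicE mem_set// scale1r addrA.
have I2 : (\int[mu]_(x in E `\` p.1) `|c + sfun_eval (p :: s) x|%:E =
    \int[mu]_(x in E `\` p.1) `|c + sfun_eval s x|%:E)%E.
  apply: eq_integral => x; rewrite inE => -[_ px].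
  by rewrite sfun_eval_cons indicE memNset// scale0r add0r.
rewrite I1 I2; apply: le_trans (leeD E1 E2); rewrite -EFinD lee_fin.
apply: le_trans (ler_normD _ _); rewrite le_eqVlt; apply/orP; left; apply/eqP.
congr (`|_|).
have -> : sint E (p :: s) = fine (mu (E `&` p.1)) *: p.2 +
    (sint (E `&` p.1) s + sint (E `\` p.1) s).
  rewrite /sint big_cons setIC -big_split; congr (_ + _).
  apply: eq_big_seq => q /ms[mq qfin] /=; rewrite -scalerDl; congr (_ *: _).
  rewrite (@fine_measureDI _ p.1)//; last exact: measurableI.
  by rewrite -setIA setIDA.
have -> : fine (mu E) *: c =
    fine (mu (E `&` p.1)) *: c + fine (mu (E `\` p.1)) *: c.
  case: Ec => [Efin|->]; last by rewrite !scaler0 addr0.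
  by rewrite -scalerDl -fine_measureDI.
rewrite scalerDr [in RHS]addrACA -[LHS]addrA [LHS]addrCA; congr (_ + _).
by rewrite [X in _ = X + _]addrC addrA.
Qed.

Lemma norm_sint_le E s : measurable E -> finite_sets_seq E s ->
  (`|sint E s|%:E <= \int[mu]_(x in E) `|sfun_eval s x|%:E)%E.
Proof.
move=> mE fs; have := norm_sint_le_add mE fs (or_intror (erefl (0 : B))).
by rewrite scaler0 addr0; under eq_integral do rewrite add0r.
Qed.

Lemma measurable_norm_sub D h (u : nat -> seq (set T * B)) s :
  (forall n, measurable_seq (u n)) -> measurable_seq s ->
  (forall x, D x -> sfun_eval (u n) x @[n --> \oo] --> h x) ->
  measurable_fun D (fun x => `|h x - sfun_eval s x|).
Proof.
move=> mu_ ms uh.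
apply: (@measurable_fun_cvg _ _ _ _ (fun n x => `|sfun_eval (u n) x - sfun_eval s x|)).
  by move=> n; exact: measurable_norm_sub_sfun.
move=> x Dx; apply: cvg_norm; apply: cvgB; last exact: cvg_cst.
exact: uh.
Qed.

Lemma bochner_measurable_norm D h v : is_bochner mu D h v ->
  measurable_fun D (fun x => `|h x|).
Proof.
move=> [u [mu_ [uh _]]].
have := @measurable_norm_sub D h u [::] (fun n => finite_sets_seq_measurable (mu_ n)) _ uh.
have -> : (fun x => `|h x - sfun_eval [::] x|) = (fun x => `|h x|).
  by apply/funext => x; rewrite sfun_eval_nil subr0.
by apply.
Qed.

Lemma eq_bochner D h h' v : (forall x, D x -> h x = h' x) ->
  is_bochner mu D h v -> is_bochner mu D h' v.
Proof.
move=> hh' [u [mu_ [uh [ui uv]]]]; exists u; split=> //; split.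
  by move=> x Dx; rewrite -hh'//; exact: uh.
split=> //; rewrite [X in X @ _ --> _](_ : _ =
  (fun n => \int[mu]_(x in D) (`|h x - sfun_eval (u n) x|)%:E)%E)//.
by apply/funext => n; apply: eq_integral => x; rewrite inE => Dx; rewrite hh'.
Qed.

Lemma bochner_simple D s : finite_sets_seq D s ->
  is_bochner mu D (sfun_eval s) (sint D s).
Proof.
move=> fs; exists (fun=> s); split; first by move=> _; exact: fs.
split; first by move=> x _; exact: cvg_cst.
split; last exact: cvg_cst.
rewrite [X in X @ _ --> _](_ : _ = fun=> 0%E); first exact: cvg_cst.
by apply/funext => _; apply: integral0_eq => x _; rewrite subrr normr0.
Qed.

Lemma bochner_linear D h h' v v' (a : R) : measurable D ->
  is_bochner mu D h v -> is_bochner mu D h' v' ->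
  is_bochner mu D (fun x => h x + a *: h' x) (v + a *: v').
Proof.
move=> mD [u [fu [uh [ui uv]]]] [u' [fu' [uh' [ui' uv']]]].
have mu_ n := finite_sets_seq_measurable (fu n).
have mu'_ n := finite_sets_seq_measurable (fu' n).
exists (fun n => u n ++ scale_seq a (u' n)); split.
  by move=> n; apply: finite_sets_seq_cat; [exact: fu|exact/finite_sets_seq_scale/fu'].
split.
  move=> x Dx; under eq_fun do rewrite sfun_eval_cat sfun_eval_scale.
  by apply: cvgD; [exact: uh|apply: cvgZl_tmp; exact: uh'].
split; last first.
  rewrite [X in X @ _ --> _](_ : _ = fun n => sint D (u n) + a *: sint D (u' n)).
    by apply: cvgD => //; exact: cvgZl_tmp.
  by apply/funext => n; rewrite -sint_scale -sint_cat.
pose I n := (\int[mu]_(x in D) `|h x - sfun_eval (u n) x|%:E)%E.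
pose I' n := (\int[mu]_(x in D) `|h' x - sfun_eval (u' n) x|%:E)%E.
apply: (@squeeze_cvge _ _ _ _ (fun=> 0%E) _ (fun n => I n + `|a|%:E * I' n)%E).
- apply: nearW => n; rewrite integral_ge0//=.
  rewrite /I' -ge0_integralZl//; last first.
    by apply/measurable_EFinP; exact: measurable_norm_sub uh'.
  rewrite /I -ge0_integralD//; last 2 first.
    by apply/measurable_EFinP; exact: measurable_norm_sub uh.
    apply: measurable_funeM; apply/measurable_EFinP; exact: measurable_norm_sub uh'.
  apply: ge0_le_integral => //.
  + apply/measurable_EFinP; apply: (@measurable_norm_sub _ _
      (fun n => u n ++ scale_seq a (u' n))).
    * move=> k; apply: (@finite_sets_seq_measurable D); apply: finite_sets_seq_cat; [exact: fu|exact/finite_sets_seq_scale/fu'].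
    * apply: (@finite_sets_seq_measurable D); apply: finite_sets_seq_cat; [exact: fu|exact/finite_sets_seq_scale/fu'].
    * move=> x Dx; under eq_fun do rewrite sfun_eval_cat sfun_eval_scale.
      by apply: cvgD; [exact: uh|apply: cvgZl_tmp; exact: uh'].
  + apply: emeasurable_funD; first by apply/measurable_EFinP; exact: measurable_norm_sub uh.
    by apply: measurable_funeM; apply/measurable_EFinP; exact: measurable_norm_sub uh'.
  + move=> x _; rewrite -EFinM -EFinD lee_fin sfun_eval_cat sfun_eval_scale.
    by rewrite opprD addrACA -scalerBr (le_trans (ler_normD _ _))// normrZ.
- exact: cvg_cst.
- rewrite -[X in _ --> X](adde0 0%E) -[X in _ --> (_ + X)%E](mule0 `|a|%:E).
  apply: cvgeD => //; exact: cvgeZl.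
Qed.

Lemma bochner_sum D (I : Type) (r : seq I) (c : I -> R) (h : I -> T -> B)
    (v : I -> B) : measurable D -> (forall i, is_bochner mu D (h i) (v i)) ->
  is_bochner mu D (fun x => \sum_(i <- r) c i *: h i x) (\sum_(i <- r) c i *: v i).
Proof.
move=> mD hv; elim: r => [|i r ih].
  have := @bochner_simple D [::]; rewrite /sint !big_nil => /(_ _).
  by move=> /(_ ltac:(by [])); apply: eq_bochner => x _; rewrite sfun_eval_nil big_nil.
rewrite big_cons addrC; have := bochner_linear (c i) mD ih (hv i).
by apply: eq_bochner => x _; rewrite big_cons addrC.
Qed.

(** For the approximants u_n, the norm of the integral is at most int |u_n| <= int |h| + int |h -
    u_n|, and the last term tends to 0. *)
Lemma norm_bochner_le D h v : measurable D -> is_bochner mu D h v ->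
  (`|v|%:E <= \int[mu]_(x in D) `|h x|%:E)%E.
Proof.
move=> mD hv; have mh := bochner_measurable_norm hv.
case: hv => u [fu [uh [ui uv]]].
have mu_ n := finite_sets_seq_measurable (fu n).
have sv : `|sint D (u n)|%:E @[n --> \oo] --> `|v|%:E.
  by apply: cvg_EFin; [exact: nearW|exact: cvg_norm].
have Ih : (\int[mu]_(x in D) `|h x|%:E +
    \int[mu]_(x in D) `|h x - sfun_eval (u n) x|%:E)%E @[n --> \oo] -->
    (\int[mu]_(x in D) `|h x|%:E)%E.
  rewrite -[X in _ --> X]adde0; apply: cvgeD => //; last exact: cvg_cst.
  by apply: ge0_adde_def; rewrite inE ?integral_ge0.
apply: (lee_cvg_to sv Ih).
apply: nearW => n; apply: (le_trans (norm_sint_le mD (fu n))).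
rewrite -ge0_integralD//; last 2 first.
- exact/measurable_EFinP.
- by apply/measurable_EFinP; exact: measurable_norm_sub uh.
apply: ge0_le_integral => //.
- apply/measurable_EFinP; have := @measurable_norm_sfun (u n) 0 D (mu_ n).
  by under eq_fun do rewrite add0r.
- apply: emeasurable_funD; first exact/measurable_EFinP.
  by apply/measurable_EFinP; exact: measurable_norm_sub uh.
- move=> x _; rewrite -EFinD lee_fin -{1}[sfun_eval _ _](subKr (h x)).
  exact: ler_normB.
Qed.

(** The norm bound is applied to h - h. *)
Lemma bochner_unique D h v v' : measurable D ->
  is_bochner mu D h v -> is_bochner mu D h v' -> v = v'.
Proof.
move=> mD hv hv'; have := norm_bochner_le mD (bochner_linear (-1) mD hv hv').
rewrite integral0_eq => [|x _]; last by rewrite scaleN1r subrr normr0.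
by rewrite lee_fin normr_le0 scaleN1r subr_eq0 => /eqP.
Qed.

Lemma bochnerE D h v : measurable D -> is_bochner mu D h v -> bochner mu D h = v.
Proof.
by move=> mD hv; apply: (bochner_unique mD _ hv); apply: xgetPex; exists v.
Qed.

(** The same approximants serve on [A]; their integrals there form a Cauchy sequence, and
    completeness of B supplies the limit that [is_bochner] asks for. *)
Lemma bochner_restrict D A h v : measurable D -> measurable A -> A `<=` D ->
  is_bochner mu D h v -> exists w, is_bochner mu A h w.
Proof.
move=> mD mA AD [u [fu [uh [ui uv]]]].
have mu_ n := finite_sets_seq_measurable (fu n).
have fuA n : finite_sets_seq A (u n).
  move=> q /(fu n)[mq qfin]; split=> //; rewrite (le_lt_trans _ qfin)//.
  by rewrite le_measure ?inE//; [exact: measurableI|exact: measurableI|exact: setIS].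
pose I n := (\int[mu]_(x in D) `|h x - sfun_eval (u n) x|%:E)%E.
have IA n : (\int[mu]_(x in A) `|h x - sfun_eval (u n) x|%:E <= I n)%E.
  apply: ge0_subset_integral => //.
  by apply/measurable_EFinP; exact: measurable_norm_sub uh.
have dist n m : (`|sint A (u n) - sint A (u m)|%:E <= I n + I m)%E.
  rewrite -scaleN1r -sint_scale -sint_cat.
  have fnm : finite_sets_seq A (u n ++ scale_seq (-1) (u m)).
    exact/finite_sets_seq_cat/finite_sets_seq_scale.
  apply: (le_trans (norm_sint_le mA fnm)).
  apply: (le_trans _ (leeD (IA n) (IA m))); rewrite -ge0_integralD//; last 2 first.
  - by apply/measurable_EFinP; apply: (measurable_norm_sub mu_) => // x /AD /uh.
  - by apply/measurable_EFinP; apply: (measurable_norm_sub mu_) => // x /AD /uh.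
  apply: ge0_le_integral => //.
  - apply/measurable_EFinP; have := @measurable_norm_sfun _ 0 A (finite_sets_seq_measurable fnm).
    by under eq_fun do rewrite add0r.
    - by apply: emeasurable_funD; apply/measurable_EFinP;
      apply: (measurable_norm_sub mu_) => // x /AD /uh.
  - move=> x _; rewrite -EFinD lee_fin sfun_eval_cat sfun_eval_scale scaleN1r.
    apply: le_trans (ler_normB _ _).
    by rewrite opprB [X in _ <= `|X|]addrC addrA subrK distrC.
have /cauchy_cvgP : cauchy (sint A (u n) @[n --> \oo]).
  apply: cauchy_exP => e e0.
  have e20 : 0 < e / 2 by rewrite divr_gt0.
  have : \forall n \near \oo, (I n < (e / 2)%:E)%E.
    have /fine_cvgP[Ifin /cvgr0Pnorm_lt/(_ _ e20) Ie] := ui.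
    near=> n; have fn : I n \is a fin_num by near: n.
    rewrite -(fineK fn) lte_fin; apply: le_lt_trans (ler_norm _) _.
    by near: n.
  move=> [N _ IN]; exists (sint A (u N)); exists N => // n Nn.
  rewrite /= -ball_normE /= -lte_fin.
  apply: (le_lt_trans (dist _ _)); rewrite [e]splitr EFinD.
  by apply: lteD; apply: IN => //=.
move=> /cvg_ex[w uw]; exists w, u; split=> //; split; first by move=> x /AD /uh.
split=> //; apply: (@squeeze_cvge _ _ _ _ (fun=> 0%E) _ I) => //; last exact: cvg_cst.
by apply: nearW => n; rewrite integral_ge0//= IA.
Unshelve. all: by end_near. Qed.

Lemma bochner_null D A h v : measurable D -> measurable A -> A `<=` D ->
  mu (D `\` A) = 0%E -> is_bochner mu D h v -> is_bochner mu A h v.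
Proof.
move=> mD mA AD DA0 [u [fu [uh [ui uv]]]].
have mu_ n := finite_sets_seq_measurable (fu n).
have eqm (E : set T) : measurable E -> mu (E `&` A) = mu (E `&` D).
  move=> mE; rewrite (measureDI mu (measurableI _ _ mE mD) mA) -setIA (setIidr AD).
  rewrite [X in (X + _)%E](_ : _ = 0%E) ?add0e//.
  apply: (@subset_measure0 _ _ _ mu _ (D `\` A)) => //.
  - by apply: measurableD => //; exact: measurableI.
  - exact: measurableD.
  - by apply: setSD; exact: subIsetr.
exists u; split.
  by move=> n q /(fu n)[mq qfin]; split=> //; rewrite eqm.
split; first by move=> x /AD /uh.
split; last first.
  rewrite [X in X @ _ --> _](_ : _ = fun n => sint D (u n))//.
  by apply/funext => n; apply: eq_big_seq => q /(fu n)[mq _]; rewrite eqm.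
apply: (@squeeze_cvge _ _ _ _ (fun=> 0%E) _
  (fun n => (\int[mu]_(x in D) `|h x - sfun_eval (u n) x|%:E)%E)) => //; last exact: cvg_cst.
apply: nearW => n; rewrite integral_ge0//=; apply: ge0_subset_integral => //.
by apply/measurable_EFinP; exact: measurable_norm_sub uh.
Qed.

Lemma bochner_extend D A h v : measurable D -> measurable A -> A `<=` D ->
  is_bochner mu A h v -> is_bochner mu D (fun x => (\1_A x : R) *: h x) v.
Proof.
move=> mD mA AD [u [fu [uh [ui uv]]]].
have evalA n x : sfun_eval [seq (p.1 `&` A, p.2) | p <- u n] x =
    (\1_A x : R) *: sfun_eval (u n) x.
  rewrite /sfun_eval big_map scaler_sumr; apply: eq_bigr => p _ /=.
  by rewrite indicI /= scalerA mulrC.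
exists (fun n => [seq (p.1 `&` A, p.2) | p <- u n]); split.
  move=> n _ /mapP[q /(fu n)[mq qfin] ->]; split => /=; first exact: measurableI.
  by rewrite -setIA (setIidl AD).
split.
  move=> x Dx; under eq_fun do rewrite evalA.
  have [Ax|Ax] := pselect (A x).
    by apply: cvgZl_tmp; exact: uh.
  by rewrite indicE memNset//; under eq_fun do rewrite scale0r; rewrite scale0r; exact: cvg_cst.
split; last first.
  rewrite [X in X @ _ --> _](_ : _ = fun n => sint A (u n))//.
  apply/funext => n; rewrite big_map; apply: eq_bigr => q _ /=.
  by rewrite -setIA (setIidl AD).
rewrite [X in X @ _ --> _](_ : _ =
  (fun n => \int[mu]_(x in A) (`|h x - sfun_eval (u n) x|)%:E)%E)//.
apply/funext => n; rewrite -[in RHS](setIidr AD) integral_mkcondr.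
apply: eq_integral => x _; rewrite /patch evalA -scalerBr normrZ indicE.
by case: (x \in A); rewrite ?normr1 ?mul1r ?normr0 ?mul0r.
Qed.

End BochnerTheory.

(** * The 4-adic cells of Omega *)

Section Cells.
Context {R : realType} (N k : int).
Implicit Types (u w : word) (x y : R) (j : int).

(* The cells are open, so that the values of phi and psi at the endpoints,
   where neighbouring generators overlap, only matter on the countable grid. *)
Definition level (l : nat) : int := 2 * N - 2 * l%:Z.
Definition len (l : nat) : R := 2 ^ level l.
(** [k] followed by the letters of [u] as base-4 digits: the index of the interval in its dyadic
    generation. *)
Definition pos u : int := foldl (fun j (a : 'I_4) => 4 * j + a%:Z) k u.
Definition lft u : R := len (size u) * (pos u)%:~R.
Definition cell u : set R := [set x | lft u < x < lft u + len (size u)].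
Definition grid : set R := range lft.

Lemma len_gt0 l : 0 < len l. Proof. exact: exprz_gt0. Qed.

Lemma lenS l : len l.+1 = len l / 4.
Proof.
rewrite /len /level (_ : 2 * N - 2 * l.+1%:Z = (2 * N - 2 * l%:Z) + (-2)); last by lia.
by rewrite expfzDr ?pnatr_eq0//; congr (_ * _); rewrite -exprnN expr2 -natrM.
Qed.

Lemma len_exp l : 4 ^+ l * len l = len 0.
Proof.
elim: l => [|l ih]; first by rewrite expr0 mul1r.
by rewrite lenS -ih exprS; field.
Qed.

Lemma pos_rcons u (a : 'I_4) : pos (rcons u a) = 4 * pos u + a%:Z.
Proof. by rewrite /pos foldl_rcons. Qed.

Lemma lft_rcons u (a : 'I_4) :
  lft (rcons u a) = lft u + a%:R * len (size u).+1.
Proof.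
by rewrite /lft size_rcons pos_rcons lenS intrD intrM /=; field.
Qed.

Lemma dI_cell u : dI (level (size u)) (pos u) =
  [set x : R | lft u <= x < lft u + len (size u)].
Proof. by rewrite /dI /lft /len intrD mulrDr mulr1. Qed.

Lemma OmegaE : Omega N k = [set x : R | lft [::] <= x < lft [::] + len 0].
Proof.
by rewrite -(dI_cell [::]) /Omega /level /pos /=; congr dI; lia.
Qed.

Lemma cell_rcons u a : cell (rcons u a) `<=` cell u.
Proof.
move=> x; rewrite /cell /= lft_rcons size_rcons lenS.
have := len_gt0 (size u); have := ltn_ord a.
by elim/ord4P: a => /= _ l0; lra.
Qed.

Lemma cell_Omega u : cell u `<=` Omega N k.
Proof.
elim/last_ind: u => [|u a ih]; last exact: subset_trans (@cell_rcons _ _) ih.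
by rewrite OmegaE => x /= /andP[/ltW -> ->].
Qed.

(** Only four points are avoided, so the exceptional set is finite, as [bochner_off_seq] needs;
    [cell_split] avoids the whole grid. *)
Lemma cell_quarter u x : cell u x -> (forall a, lft (rcons u a) != x) ->
  exists a, cell (rcons u a) x.
Proof.
move=> ux neq; have := neq q1; have := neq q2; have := neq q3.
move: ux; rewrite /cell /= !lft_rcons /= => /andP[].
have := lenS (size u); set d := len (size u).+1 => dE.
have {dE} -> : len (size u) = 4 * d by rewrite dE; field.
move=> x1 x2; rewrite !neq_lt => n3 n2 n1.
have [h1|h1] := ltP x (lft u + 1%:R * d).
  by exists q0; rewrite /= lft_rcons size_rcons /= -/d; apply/andP; split; lra.
have [h2|h2] := ltP x (lft u + 2%:R * d).
  exists q1; rewrite /= lft_rcons size_rcons /= -/d; apply/andP; split; lra.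
have [h3|h3] := ltP x (lft u + 3%:R * d).
  exists q2; rewrite /= lft_rcons size_rcons /= -/d; apply/andP; split; lra.
exists q3; rewrite /= lft_rcons size_rcons /= -/d; apply/andP; split; lra.
Qed.

Lemma cell_split u x : cell u x -> ~ grid x -> exists a, cell (rcons u a) x.
Proof.
move=> ux xG; apply: cell_quarter => // a.
by apply/eqP => xa; apply: xG; exists (rcons u a).
Qed.

Lemma dI_Omega u : @dI R (level (size u)) (pos u) `<=` Omega N k.
Proof.
rewrite dI_cell OmegaE; elim/last_ind: u => [//|u a ih] x xa; apply: ih.
move: xa; rewrite /= lft_rcons size_rcons lenS.
have := len_gt0 (size u); have := ltn_ord a.
by elim/ord4P: a => /= _ l0; lra.
Qed.

Lemma cell_cover l x : Omega N k x -> ~ grid x ->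
  exists u, size u = l /\ cell u x.
Proof.
move=> Ox xG; elim: l => [|l [u [ul ux]]].
  exists [::]; split=> //; move: Ox; rewrite OmegaE /= => /andP[x1 x2].
  rewrite /cell /= x2 andbT lt_neqAle x1 andbT; apply/eqP => xE; apply: xG; by exists [::].
have [a xa] := cell_split ux xG.
by exists (rcons u a); rewrite size_rcons ul.
Qed.

Lemma cell_eq u w : size u = size w -> pos u = pos w -> cell u = cell w.
Proof. by move=> suw puw; rewrite /cell /lft suw puw. Qed.

Lemma cell_pos u w x : size u = size w -> cell u x -> cell w x -> pos u = pos w.
Proof.
rewrite /cell /lft /= => -> /andP[u1 u2] /andP[w1 w2].
have l0 := len_gt0 (size w).
have : len (size w) * (pos u)%:~R < len (size w) * ((pos w)%:~R + 1) by lra.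
have : len (size w) * (pos w)%:~R < len (size w) * ((pos u)%:~R + 1) by lra.
rewrite !ltr_pM2l// -[1]/(1%:~R) -!intrD !ltr_int; lia.
Qed.

(** What phi and psi have in common; the values at 0, 1 and the quarter points are left
    unspecified. *)
Definition quarter_profile (h : R -> R) (hq : 'I_4 -> R) :=
  (forall t, t < 0 \/ 1 < t -> h t = 0) /\
  (forall (a : 'I_4) t, a%:R / 4 < t < (a%:R + 1) / 4 -> h t = hq a).

Lemma phi_quarter : quarter_profile phi phiq.
Proof.
split=> [t t01|a t].
  rewrite /phi; do 3?[case: ifP; first by move=> /andP[]; lra]; by [].
rewrite /phi => /andP[]; elim/ord4P: a => /= t1 t2; rewrite /phiq /vec4 /=.
- by rewrite ifT//; apply/andP; split; lra.
- by rewrite ifF ?ifT//; [apply/andP; split|apply/negP => /andP[]]; lra.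
- by rewrite ifF ?ifT//; [apply/andP; split|apply/negP => /andP[]]; lra.
- rewrite ifF; last by apply/negP => /andP[]; lra.
  rewrite ifF; last by apply/negP => /andP[]; lra.
  by rewrite ifT//; apply/andP; split; lra.
Qed.

Lemma psi_quarter : quarter_profile psi psiq.
Proof.
split=> [t t01|a t].
  rewrite /psi; do 4?[case: ifP; first by move=> /andP[]; lra]; by [].
rewrite /psi => /andP[]; elim/ord4P: a => /= t1 t2; rewrite /psiq /vec4 /=.
- by rewrite ifT//; apply/andP; split; lra.
- rewrite ifF; last by apply/negP => /andP[]; lra.
  by rewrite ifT//; apply/andP; split; lra.
- rewrite ifF; last by apply/negP => /andP[]; lra.
  rewrite ifF; last by apply/negP => /andP[]; lra.
  by rewrite ifT//; apply/andP; split; lra.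
- rewrite ifF; last by apply/negP => /andP[]; lra.
  rewrite ifF; last by apply/negP => /andP[]; lra.
  rewrite ifF; last by apply/negP => /andP[]; lra.
  by rewrite ifT//; apply/andP; split; lra.
Qed.

Lemma hDE (h : R -> R) l j x :
  hD h (level l) j x = (Num.sqrt (len l))^-1 * h (x / len l - j%:~R).
Proof.
rewrite /hD /hI -/(len l) intrD mulrDr mulr1 addrAC subrr add0r.
congr (_ * h _); rewrite mulrBl; congr (_ - _).
by rewrite mulrC mulKf// gt_eqF// len_gt0.
Qed.

(** The index [j] is free because generators and sums run over many intervals of one length; those
    other than the one containing [x] contribute 0. *)
Lemma hD_cell h hq u a j x : quarter_profile h hq -> cell (rcons u a) x ->
  hD h (level (size u)) j x =
  (Num.sqrt (len (size u)))^-1 * (if j == pos u then hq a else 0).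
Proof.
move=> [h_out h_in]; rewrite hDE /cell /= lft_rcons size_rcons lenS /lft.
have l0 := len_gt0 (size u); set d := len (size u) in l0 *.
move=> /andP[x1 x2]; congr (_ * _).
set t := x / d - (pos u)%:~R.
have t1 : a%:R / 4 < t.
  by rewrite /t ltrBrDr ltr_pdivlMr//; move: x1; lra.
have t2 : t < (a%:R + 1) / 4.
  by rewrite /t ltrBlDr ltr_pdivrMr//; move: x2; lra.
have a0 : 0 <= a%:R :> R by [].
have a4 : a%:R + 1 <= 4 :> R by rewrite natr1 ler_nat.
case: eqVneq => [->|]; first by apply: h_in; rewrite t1 t2.
have -> : x / d - j%:~R = t + (pos u - j)%:~R by rewrite /t intrB; ring.
rewrite neq_lt => /orP[jp|jp]; apply: h_out; [right|left].
  have : 1%:~R <= (pos u - j)%:~R :> R by rewrite ler_int; lia.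
  move=> H; lra.
have : (pos u - j)%:~R <= (-1)%:~R :> R by rewrite ler_int; lia.
move=> H; lra.
Qed.

Lemma hD_out h hq u x : quarter_profile h hq ->
  x < lft u \/ lft u + len (size u) < x -> hD h (level (size u)) (pos u) x = 0.
Proof.
move=> [h_out _] xu; rewrite hDE h_out ?mulr0//.
have l0 := len_gt0 (size u); move: xu; rewrite /lft => -[xu|xu]; [left|right].
  by rewrite subr_lt0 ltr_pdivrMr// mulrC.
by rewrite ltrBrDr ltr_pdivlMr// mulrDl mul1r addrC mulrC.
Qed.

Lemma cell_itv u : cell u = [set` `]lft u, lft u + len (size u)[].
Proof. by apply/seteqP; split=> x; rewrite /cell /= in_itv. Qed.

Lemma measurable_cell u : measurable (cell u : set (measurableTypeR R)).
Proof. by rewrite cell_itv; exact: measurable_itv. Qed.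

Lemma leb_cell u : leb (cell u) = (len (size u))%:E.
Proof.
rewrite cell_itv /leb lebesgue_measure_itv /= lte_fin ltrDl len_gt0.
by rewrite -EFinB addrAC subrr add0r.
Qed.

Lemma measurable_Omega : measurable (Omega N k : set (measurableTypeR R)).
Proof.
rewrite OmegaE (_ : [set x | _] = [set` `[lft [::], lft [::] + len 0[])//.
Qed.

Lemma countable_grid : countable grid.
Proof. exact: card_le_trans (card_image_le _ _) (countableP _). Qed.

Lemma measurable_grid : measurable (grid : set (measurableTypeR R)).
Proof. by apply: countable_measurable countable_grid => t; exact: measurable_set1. Qed.

Lemma leb_grid : leb grid = 0%E.
Proof. exact: countable_lebesgue_measure0 countable_grid. Qed.

End Cells.

(** * Integrals of psi_I over cells *)

Section CellIntegrals.
Context {R : realType} (N k : int).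
Implicit Types (u w : word) (x : R) (j : int) (D E : set (measurableTypeR R)).
Local Notation level := (level N).
Local Notation len := (@len R N).
Local Notation pos := (pos k).
Local Notation cell := (@cell R N k).
Local Notation grid := (@grid R N k).

Lemma measurable_phi : measurable_fun setT (@phi R).
Proof.
by rewrite /phi; do 3![apply: measurable_fun_ifT => //;
  first by apply: measurable_and;
    first [apply: measurable_fun_ler|apply: measurable_fun_ltr]].
Qed.

Lemma measurable_psi : measurable_fun setT (@psi R).
Proof.
by rewrite /psi; do 4![apply: measurable_fun_ifT => //;
  first by apply: measurable_and;
    first [apply: measurable_fun_ler|apply: measurable_fun_ltr]].
Qed.

Lemma measurable_hD (h : R -> R) l j D :
  measurable_fun setT h -> measurable_fun D (hD h (level l) j).
Proof.
move=> mh; rewrite (_ : hD _ _ _ = fun x =>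
  (Num.sqrt (len l))^-1 * h (x / len l - j%:~R)); last first.
  by apply/funext => x; rewrite hDE.
apply: measurable_funTS; apply: measurable_funM; first exact: measurable_cst.
apply: (measurableT_comp mh); apply: measurable_funB; last exact: measurable_cst.
by apply: measurable_funM => //; exact: measurable_cst.
Qed.

Lemma psi_bounded x : `|psi x| <= 7.
Proof.
rewrite /psi; do 4?[case: ifP => _; first by rewrite ?normrN normr_nat || rewrite ?normrN1 ?normr1; lra].
by rewrite normr0.
Qed.

Lemma integrable_hD_psi l j D : measurable D -> (leb D < +oo)%E ->
  leb.-integrable D (EFin \o hD (@psi R) (level l) j).
Proof.
move=> mD Dfin; apply: measurable_bounded_integrable => //.
  by apply: measurable_hD; exact: measurable_psi.
exists ((Num.sqrt (len l))^-1 * 7); split; first exact: num_real.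
move=> c hc x Dx; rewrite /= hDE normrM (le_trans _ (ltW hc))//.
rewrite ger0_norm ?invr_ge0 ?sqrtr_ge0//.
by apply: ler_wpM2l; rewrite ?invr_ge0 ?sqrtr_ge0// psi_bounded.
Qed.

Lemma integral_off_grid D E (f : R -> R) : measurable D -> measurable E ->
  leb.-integrable D (EFin \o f) -> E `<=` D -> D `\` grid `<=` E ->
  (\int[leb]_(x in D) (f x)%:E = \int[leb]_(x in E) (f x)%:E)%E.
Proof.
move=> mD mE fD ED DE; have mG := measurable_grid N k (R := R).
have fE := integrableS mD mE ED fD.
rewrite (@negligible_integral _ _ _ leb D grid)//; last exact: leb_grid.
rewrite [RHS](@negligible_integral _ _ _ leb E grid)//; last exact: leb_grid.
congr integral; apply/seteqP; split => [x xDG|x [Ex xG]].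
  by split; [exact: DE|case: xDG].
by split=> //; exact: ED.
Qed.

Definition subcells u : set R := \big[setU/set0]_(a <- enum 'I_4) cell (rcons u a).

Lemma subcellsP u x : subcells u x <-> exists a, cell (rcons u a) x.
Proof.
rewrite /subcells -bigcup_seq; split=> [[a _ xa]|[a xa]]; first by exists a.
by exists a => //=; rewrite mem_enum.
Qed.

Lemma measurable_subcells u : measurable (subcells u : set (measurableTypeR R)).
Proof. by apply: bigsetU_measurable => a _; exact: measurable_cell. Qed.

Lemma trivIset_subcells u : trivIset setT (fun a => cell (rcons u a)).
Proof.
apply/trivIsetP => a b _ _ ab; apply/seteqP; split=> // x [xa xb].
have := cell_pos _ xa xb; rewrite !size_rcons !pos_rcons => /(_ erefl) ?.
by move/eqP: ab; apply; apply: val_inj => /=; lia.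
Qed.

Lemma subcells_sub u : subcells u `<=` cell u.
Proof. by move=> x /subcellsP[a]; exact: cell_rcons. Qed.

Lemma cell_subcells u : cell u `\` grid `<=` subcells u.
Proof. by move=> x [ux xG]; apply/subcellsP; exact: cell_split ux xG. Qed.

Lemma integral_cell_split u (f : R -> R) : leb.-integrable (cell u) (EFin \o f) ->
  (\int[leb]_(x in cell u) (f x)%:E =
   \sum_a \int[leb]_(x in cell (rcons u a)) (f x)%:E)%E.
Proof.
move=> fu; have mf := measurable_int _ (integrableS (measurable_cell N k u)
  (measurable_subcells u) (@subcells_sub u) fu).
rewrite (integral_off_grid (measurable_cell N k u) (measurable_subcells u) fu);
  [|exact: subcells_sub|exact: cell_subcells].
rewrite integral_bigsetU_EFin ?enum_uniq//; first by rewrite big_enum.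
  by move=> a; exact: measurable_cell.
exact: (sub_trivIset (@subsetT _ _) (@trivIset_subcells u)).
Qed.

Lemma cell_take w l : cell w `<=` cell (take l w).
Proof.
elim/last_ind: w => [|w a ih] // x xw.
have [lw|] := leqP l (size w).
  by rewrite -cats1 takel_cat//; apply: ih; exact: cell_rcons xw.
by move=> wl; rewrite take_oversize// size_rcons.
Qed.

Lemma letter_cell w l x : (l < size w)%N -> cell w x ->
  cell (rcons (take l w) (letter w l)) x.
Proof. by move=> lw xw; rewrite -take_nth//; exact: cell_take. Qed.

Lemma integral_hD_coarse w l j : (l < size w)%N ->
  (\int[leb]_(x in cell w) (hD psi (level l) j x)%:E =
   (len (size w) * ((Num.sqrt (len l))^-1 *
     (if j == pos (take l w) then psiq (letter w l) else 0)))%:E)%E.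
Proof.
move=> lw; have sl : size (take l w) = l by rewrite size_take lw.
rewrite (eq_integral (cst ((Num.sqrt (len l))^-1 *
     (if j == pos (take l w) then psiq (letter w l) else 0))%:E)); last first.
  move=> x; rewrite inE => xw.
  by have := hD_cell j (@psi_quarter R) (letter_cell lw xw); rewrite sl => ->.
set c := _ * _; transitivity (c%:E * leb (cell w))%E.
  by apply: integral_cst; exact: measurable_cell.
by rewrite leb_cell -EFinM mulrC.
Qed.

Lemma leb_cell_fin w : (leb (cell w) < +oo)%E.
Proof. by rewrite leb_cell ltry. Qed.

(** psi has mean zero: the cell is cut down to the size of I, where the four quarter values 7, -1,
    1, -7 cancel. *)
Lemma integral_hD_fine w l j : (size w <= l)%N ->
  (\int[leb]_(x in cell w) (hD psi (level l) j x)%:E = 0)%E.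
Proof.
move=> /subnKC; move: (l - size w)%N => n; elim: n w => [|n ih] w wl.
  rewrite integral_cell_split; last first.
    by apply: integrable_hD_psi; [exact: measurable_cell|exact: leb_cell_fin].
  rewrite big_ord4 !integral_hD_coarse ?size_rcons -?wl ?addn0//.
  rewrite !nth_rcons ltnn eqxx -!cats1 !take_size_cat// -!EFinD; congr EFin.
  by case: ifP => _; rewrite /psiq /vec4 /=; ring.
rewrite integral_cell_split; last first.
  by apply: integrable_hD_psi; [exact: measurable_cell|exact: leb_cell_fin].
by rewrite big1// => a _; rewrite ih// size_rcons addSnnS.
Qed.

End CellIntegrals.

(** * Averages of f over cells and the pairings with phi_I *)

Section CellAverages.
Context {R : realType} {B : completeNormedModType R} (N k : int).
Variable f : R -> B.
Hypothesis f_int : bochner_integrable leb setT f.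
Implicit Types (u w : word) (x : R) (j : int).
Local Notation level := (level N).
Local Notation len := (@len R N).
Local Notation pos := (pos k).
Local Notation lft := (@lft R N k).
Local Notation cell := (@cell R N k).
Local Notation grid := (@grid R N k).

Definition cell_int u : B := bochner leb (cell u) f.
Definition avg u : B := (len (size u))^-1 *: cell_int u.

Lemma cell_intP u : is_bochner leb (cell u) f (cell_int u).
Proof.
have [v fv] := f_int; have mu := measurable_cell N k u (R := R).
have [w fw] := bochner_restrict measurableT mu (@subsetT _ _) fv.
by rewrite /cell_int (bochnerE mu fw).
Qed.

Lemma sum_subcells u b x (c : 'I_4 -> R) (z : B) : cell (rcons u b) x ->
  \sum_a c a *: ((\1_(cell (rcons u a)) x : R) *: z) = c b *: z.
Proof.
move=> xb; rewrite (bigD1 b)//= indicE mem_set// scale1r big1 ?addr0// => a ab.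
rewrite indicE memNset ?scale0r ?scaler0// => xa.
have /trivIsetP/(_ a b I I ab) := @trivIset_subcells R N k u.
by move=> /seteqP[/(_ x (conj xa xb))].
Qed.

Lemma cell_int_split u : cell_int u = \sum_a cell_int (rcons u a).
Proof.
have mD := measurable_subcells N k u (R := R); have mu := measurable_cell N k u (R := R).
have fD : is_bochner leb (subcells N k u) f (cell_int u).
  apply: (bochner_null mu mD) => //; last exact: cell_intP.
    exact: subcells_sub.
  apply: (@subset_measure0 _ _ _ leb _ grid).
  - exact: measurableD.
  - exact: measurable_grid.
  - by move=> x [ux nx]; apply: contrapT => xG; apply: nx; exact: cell_subcells.
  - exact: leb_grid.
apply: (bochner_unique mD fD).
rewrite (eq_bigr (fun a => (1 : R) *: cell_int (rcons u a))) => [|a _]; last first.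
  by rewrite scale1r.
have := bochner_sum (index_enum 'I_4) (fun=> 1) mD (fun a => bochner_extend mD
  (measurable_cell N k (rcons u a))
  (fun x xa => (subcellsP N k u x).2 (ex_intro _ a xa)) (cell_intP (rcons u a))).
apply: eq_bochner => x /subcellsP[b xb].
by rewrite (@sum_subcells u b x (fun=> 1))// scale1r.
Qed.

Lemma avg_split u : avg u = 4^-1 *: \sum_a avg (rcons u a).
Proof.
rewrite /avg cell_int_split !scaler_sumr; apply: eq_bigr => a _.
rewrite scalerA size_rcons lenS; congr (_ *: _).
by field; rewrite gt_eqF// len_gt0.
Qed.

Lemma norm_avg_le u : ((len (size u) * `|avg u|)%:E <=
  \int[leb]_(x in cell u) `|f x|%:E)%E.
Proof.
rewrite /avg normrZ gtr0_norm ?invr_gt0 ?len_gt0// mulVKf ?gt_eqF ?len_gt0//.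
by apply: norm_bochner_le; [exact: measurable_cell|exact: cell_intP].
Qed.

Lemma leb_set1 (z : R) : leb [set z] = 0%E.
Proof. exact: lebesgue_measure_set1. Qed.

(** [is_bochner] asks for convergence at every point, so a change on a null set is not free. For a
    finite set the approximants are corrected by a simple function of integral 0; [undup] corrects
    each point once. *)
Lemma bochner_off_seq (D : set (measurableTypeR R)) (h h' : R -> B) (v : B)
    (Z : seq R) : measurable D ->
  (forall x, D x -> x \notin Z -> h x = h' x) ->
  is_bochner leb D h v -> is_bochner leb D h' v.
Proof.
move=> mD hh' hv.
have z0 (z : R) : (leb : {measure set _ -> \bar R}) ([set z] `&` D) = 0%E.
  apply: (@subset_measure0 _ _ _ leb _ [set z]).
  - by apply: measurableI.
  - by [].
  - exact: subIsetl.
  - exact: leb_set1.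
pose s := [seq ([set z] : set (measurableTypeR R), h' z - h z) | z <- undup Z].
have fs : finite_sets_seq leb D s.
  move=> _ /mapP[z _ ->]; split; first exact: measurable_set1.
  by rewrite z0.
have := bochner_linear 1 mD hv (bochner_simple fs).
rewrite (_ : sint leb D s = 0) ?scaler0 ?addr0; last first.
  by rewrite /sint big_map big1// => z _; rewrite z0 scale0r.
apply: eq_bochner => x Dx; rewrite scale1r /sfun_eval big_map.
have [xZ|xZ] := boolP (x \in Z); last first.
  rewrite big_seq big1 ?addr0; first exact: hh'.
  move=> z; rewrite mem_undup => zZ; rewrite indicE memNset ?scale0r//= => xz.
  by move: xZ; rewrite xz zZ.
rewrite (bigD1_seq x) ?undup_uniq ?mem_undup//= indicE mem_set// scale1r.
rewrite big1 => [|z zx]; first by rewrite addr0 addrC subrK.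
by rewrite indicE memNset ?scale0r//= => xz; rewrite xz eqxx in zx.
Qed.

Lemma pairing_phi u : pairing f phi (level (size u)) (pos u) =
  Num.sqrt (len (size u)) *: phi_coef avg u.
Proof.
set r := Num.sqrt _; have r0 : r != 0 by rewrite sqrtr_eq0 -ltNge len_gt0.
have rr : r * r = len (size u) by rewrite -expr2 sqr_sqrtr// ltW// len_gt0.
rewrite /pairing.
transitivity (\sum_a (r^-1 * phiq a) *: cell_int (rcons u a)); last first.
  rewrite /phi_coef !scaler_sumr; apply: eq_bigr => a _.
  rewrite /avg size_rcons lenS !scalerA -rr; congr (_ *: _).
  by field.
apply: bochnerE => //; have := bochner_sum (index_enum 'I_4)
  (fun a => r^-1 * phiq a) measurableT (fun a => bochner_extend measurableT
    (measurable_cell N k (rcons u a)) (@subsetT _ _) (cell_intP (rcons u a))).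
(* The exceptions are the left ends of the four quarters and the right end of I, where phi_I is
   nonzero but the open cells do not reach. *)
apply: (bochner_off_seq (Z := rcons [seq lft (rcons u a) | a <- enum 'I_4]
  (lft u + len (size u)))) => // x _.
rewrite mem_rcons inE negb_or => /andP[xr xl].
have neq a : lft (rcons u a) != x.
  by apply: contraNneq xl => <-; apply: (map_f (fun a => lft (rcons u a))); rewrite mem_enum.
have lft0 : lft u != x by have := neq q0; rewrite lft_rcons mul0r addr0.
have [ux|ux] := pselect (cell u x).
  have [b xb] := cell_quarter ux neq.
  rewrite (@sum_subcells u b x (fun a => r^-1 * phiq a))//; congr (_ *: _).
  by rewrite (hD_cell (pos u) (@phi_quarter R) xb) eqxx.
rewrite (hD_out (@phi_quarter R)) ?scale0r; last first.
  have [x1|x1] := ltP x (lft u); [by left|right].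
  have {}x1 : lft u < x by rewrite lt_neqAle lft0.
  rewrite ltNge; apply/negP => x2; apply: ux.
  by rewrite /(cell _) /= x1 lt_neqAle xr.
apply: big1 => a _; rewrite indicE memNset ?scale0r ?scaler0// => xa.
by apply: ux; exact: cell_rcons xa.
Qed.

End CellAverages.

(** * The value of the conditional expectations *)

Section ProfileValues.
Context {R : realType}.

(** With [psiq_neq0], this makes the level set of psi_I at a quarter value equal to that single
    quarter, off the grid. *)
Lemma psiq_inj : injective (@psiq R).
Proof. by elim/ord4P; elim/ord4P; rewrite /psiq /vec4 //= => ?; exfalso; lra. Qed.

Lemma psiq_neq0 a : @psiq R a != 0.
Proof. by apply/eqP; elim/ord4P: a; rewrite /psiq /vec4 /= => ?; lra. Qed.

Lemma phiq_neq0 a : @phiq R a != 0.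
Proof. by apply/eqP; elim/ord4P: a; rewrite /phiq /vec4 /= => ?; lra. Qed.

(** The level sets of phi_I join a quarter with its mirror image, and by [psiq_swap] psi_I cancels
    over such a pair. *)
Lemma phiq_eq a b : @phiq R a = phiq b -> b = a \/ b = phi_swap true a.
Proof.
by elim/ord4P: a; elim/ord4P: b; rewrite /phiq /vec4 //= => ?;
  first [by left|by right|exfalso; lra].
Qed.

Lemma phiq_swap a : @phiq R (phi_swap true a) = phiq a.
Proof. by elim/ord4P: a. Qed.

Lemma psiq_swap a : @psiq R a + psiq (phi_swap true a) = 0.
Proof. by elim/ord4P: a; rewrite /psiq /vec4 /=; lra. Qed.

Lemma phi_swap_neq a : a != phi_swap true a.
Proof. by elim/ord4P: a. Qed.

End ProfileValues.

Section Atoms.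
Context {R : realType} {B : completeNormedModType R} (N k : int).
Variable f : R -> B.
Hypothesis f_int : bochner_integrable leb setT f.
Variable gamma : int * int -> R.
Variable g : nat -> R -> B.
Hypothesis g_ce : forall n, cond_exp_version N k f gamma n (g n).
Implicit Types (u w : word) (x : R) (j : int) (A E : set (measurableTypeR R)).
Local Notation level := (level N).
Local Notation len := (@len R N).
Local Notation pos := (pos k).
Local Notation cell := (@cell R N k).
Local Notation grid := (@grid R N k).

Definition word_gamma u : R := gamma (level (size u), pos u).
Definition shift_value u : B := shift_fun (avg N k f) word_gamma u.

(** The hypothesis says that integrating psi_I over [A] gives [e] times its value on the cell of [u]
    when I is longer than that cell, and 0 otherwise. At most one interval of each length survives,
    so the partial sums are constant from [size u] on. *)
Lemma shift_partial_sum A u (e : R) :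
  (forall l j, fine (\int[leb]_(x in A) (hD psi (level l) j x)%:E)%E =
    if (l < size u)%N then e * ((Num.sqrt (len l))^-1 *
      (if j == pos (take l u) then psiq (letter u l) else 0)) else 0) ->
  forall L, (size u <= L)%N ->
  \sum_(l < L) \sum_(I \in @evenSub R N k l)
    (fine (\int[leb]_(x in A) (hD psi I.1 I.2 x)%:E)%E * gamma I)
      *: pairing f phi I.1 I.2 = e *: shift_value u.
Proof.
move=> intA L uL; rewrite /shift_value /shift_fun scaler_sumr.
rewrite (big_ord_widen L (fun l => e *: ((word_gamma (take l u) * psiq (letter u l))
  *: phi_coef (avg N k f) (take l u))) uL) big_mkcond /=.
transitivity (\sum_(l < L) (if (l < size u)%N then e *: ((word_gamma (take l u) * psiq (letter u l))
  *: phi_coef (avg N k f) (take l u)) else 0)); last by rewrite -big_mkcond.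
apply: eq_bigr => l _; case: ifP => lu; last first.
  by apply: fsbig1 => -[n j] [/= -> _]; rewrite intA lu mul0r scale0r.
have sl : size (take l u) = l by rewrite size_take lu.
rewrite -(@fsbig_widen _ _ _ _ [set (level l, pos (take l u))]); last 2 first.
- by move=> _ /= ->; split=> //=; rewrite -{1}sl; exact: dI_Omega.
- move=> [n j] /= [[/= nl _] /eqP jn]; rewrite nl intA lu.
  move: jn; rewrite nl xpair_eqE eqxx /= => /negbTE ->.
  by rewrite !mulr0 mul0r scale0r.
have := pairing_phi N k f_int (take l u); rewrite sl => pairl.
rewrite fsbig_set1 /= intA lu eqxx pairl.
rewrite /word_gamma sl !scalerA; congr (_ *: _).
have r0 : Num.sqrt (len l) != 0 by rewrite sqrtr_eq0 -ltNge len_gt0.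
by field.
Qed.

(** [E] is [A] up to grid points. Sets of the sigma-algebra do not separate points of [E], so the
    strongly measurable [g n] is constant there, and its prescribed integral over [A] determines the
    constant. *)
Lemma atom_value n A E u (e : R) :
  FOm N k n A -> measurable A -> measurable E -> E `<=` A -> A `<=` Omega N k ->
  A `\` grid `<=` E -> leb E = e%:E -> 0 < e ->
  (forall S, FOm N k n S -> forall x y, E x -> E y -> S x -> S y) ->
  (forall l j, fine (\int[leb]_(x in A) (hD psi (level l) j x)%:E)%E =
    if (l < size u)%N then e * ((Num.sqrt (len l))^-1 *
      (if j == pos (take l u) then psiq (letter u l) else 0)) else 0) ->
  forall x, E x -> g n x = shift_value u.
Proof.
move=> FA mA mE EA AO AE Ee e0 sat intA x Ex.
have [[s [Fs sg]] ce] := g_ce n; have [v [gv lim_v]] := ce A FA.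
have gE y : E y -> g n y = g n x.
  move=> Ey; have sxy i : sfun_eval (s i) y = sfun_eval (s i) x.
    rewrite /sfun_eval; apply: eq_big_seq => q /Fs Fq; congr (_ *: _).
    rewrite !indicE; congr ((nat_of_bool _)%:R).
    by apply/idP/idP; rewrite !inE; apply: sat.
  have gx := sg x (AO _ (EA _ Ex)); have := sg y (AO _ (EA _ Ey)).
  under eq_fun do rewrite sxy.
  by move/(cvg_lim (@norm_hausdorff _ _)) <-; exact/(cvg_lim (@norm_hausdorff _ _)).
have vE : v = e *: shift_value u.
  apply/esym/(cvg_unique _ _ lim_v); first exact: norm_hausdorff.
  apply: cvg_near_cst; exists (size u) => // L /= uL.
  exact: shift_partial_sum.
have A0 : (leb : {measure set _ -> \bar R}) (A `\` E) = 0%E.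
  apply: (@subset_measure0 _ _ _ leb _ grid).
  - exact: measurableD.
  - exact: measurable_grid.
  - by move=> y [Ay nE]; apply: contrapT => yG; apply: nE; exact: AE.
  - exact: leb_grid.
have gEv := bochner_null mA mE EA A0 gv.
have Efin : finite_sets_seq leb E [:: (E, g n x)].
  move=> q; rewrite inE => /eqP ->; split=> //=.
  by rewrite setIid [X in (X < _)%E]Ee ltry.
have gEc : is_bochner leb E (g n) (e *: g n x).
  have := bochner_simple Efin; rewrite /sint big_seq1 /= setIid.
  rewrite (_ : fine _ = e); last by rewrite -[RHS]/(fine e%:E) -Ee.
  apply: eq_bochner => y Ey.
  by rewrite /sfun_eval big_seq1 /= indicE mem_set// scale1r gE.
have := bochner_unique mE gEc gEv; rewrite vE.
by move/(scalerI (lt0r_neq0 e0)).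
Qed.

(** The sets that do not separate points of [E] form a sigma-algebra on Omega containing the
    generators. *)
Lemma saturated_gens (h : R -> R) i E : E `<=` Omega N k ->
  (forall j x y, E x -> E y -> hD h (level i) j x = hD h (level i) j y) ->
  forall S, <<s Omega N k, gens h N k i >> S ->
  forall x y, E x -> E y -> S x -> S y.
Proof.
move=> EO hE S FS.
apply: (FS [set S : set R | forall x y, E x -> E y -> S x -> S y]).
split; first split.
- by [].
- by move=> A hA x y Ex Ey [Ox Ax]; split; [exact: EO|move=> Ay; apply/Ax/(hA y)].
- by move=> F hF x y Ex Ey [m _ Fx]; exists m => //; exact: (hF m x).
move=> _ [j [A [_ [_ ->]]]] x y Ex Ey [Ox /= Ax]; split; first exact: EO.
by rewrite /= -(hE j x y).
Qed.

Lemma gens_fiber (h : R -> R) u (c : R) : <<s Omega N k, gens h N k (size u) >>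
  (Omega N k `&` (hD h (level (size u)) (pos u) @^-1` [set c])).
Proof.
apply: sub_sigma_algebra; exists (pos u), [set c]; split; first exact: dI_Omega.
by split; first exact: measurable_set1.
Qed.

Lemma measurable_fiber (h : R -> R) l j (c : R) : measurable_fun setT h ->
  measurable (Omega N k `&` (hD h (level l) j @^-1` [set c]) : set (measurableTypeR R)).
Proof.
move=> mh; apply: (@measurable_hD _ N h l j (Omega N k) mh).
  exact: measurable_Omega.
exact: measurable_set1.
Qed.

Lemma leb_Omega_fin A : measurable A -> A `<=` Omega N k -> (leb A < +oo)%E.
Proof.
move=> mA AO; have mO := measurable_Omega N k (R := R).
apply: (@le_lt_trans _ _ (leb (Omega N k))).
  by apply: le_measure => //; rewrite inE.
rewrite OmegaE (_ : [set x | _] =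
  [set` `[lft N k [::], lft N k [::] + len 0[]); last first.
  by apply/seteqP; split=> x; rewrite /= in_itv.
by rewrite /leb lebesgue_measure_itv /=; case: ifP; rewrite ?ltry.
Qed.

Lemma integral_psi_off_grid A E l j : measurable A -> measurable E ->
  A `<=` Omega N k -> E `<=` A -> A `\` grid `<=` E ->
  (\int[leb]_(x in A) (hD psi (level l) j x)%:E =
   \int[leb]_(x in E) (hD psi (level l) j x)%:E)%E.
Proof.
move=> mA mE AO EA AE; apply: (@integral_off_grid R N k) => //.
by apply: integrable_hD_psi => //; exact: leb_Omega_fin.
Qed.

Lemma integral_cell_psi u l j :
  fine (\int[leb]_(x in cell u) (hD psi (level l) j x)%:E)%E =
    if (l < size u)%N then len (size u) * ((Num.sqrt (len l))^-1 *
      (if j == pos (take l u) then psiq (letter u l) else 0)) else 0.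
Proof.
case: ltnP => lu; first by rewrite integral_hD_coarse.
by rewrite integral_hD_fine.
Qed.

Lemma g_zero x : cell [::] x -> g 0 x = shift_value [::].
Proof.
have mO := measurable_Omega N k (R := R).
have OG : Omega N k `\` grid `<=` cell [::].
  by move=> y [Oy yG]; have [w [/size0nil -> //]] := cell_cover 0 Oy yG.
apply: (@atom_value 0 (Omega N k) _ _ (len 0)) => //.
- by rewrite /FOm eqxx; right.
- exact: measurable_cell.
- exact: cell_Omega.
- exact: leb_cell.
- exact: len_gt0.
- rewrite /FOm eqxx => S [->//|->] y z _ Ez _; exact: cell_Omega Ez.
- move=> l j; rewrite (integral_psi_off_grid _ _ mO (measurable_cell N k [::]))//.
    exact: integral_cell_psi.
  exact: cell_Omega.
Qed.

Lemma sqrt_len_inj l : injective ( *%R (Num.sqrt (len l))^-1).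
Proof.
by apply: mulfI; rewrite invr_eq0 sqrtr_eq0 -ltNge len_gt0.
Qed.

Lemma g_even u a x : cell (rcons u a) x ->
  g (size u).*2.+2 x = shift_value (rcons u a).
Proof.
pose c := (Num.sqrt (len (size u)))^-1 * psiq a.
pose A : set (measurableTypeR R) :=
  Omega N k `&` (hD psi (level (size u)) (pos u) @^-1` [set c]).
have mA : measurable A by apply: measurable_fiber; exact: measurable_psi.
have mE := measurable_cell N k (rcons u a) (R := R).
have AO : A `<=` Omega N k by exact: subIsetl.
have EA : cell (rcons u a) `<=` A.
  move=> y ya; split; first exact: cell_Omega ya.
  by rewrite /= (hD_cell _ (@psi_quarter R) ya) eqxx.
have AE : A `\` grid `<=` cell (rcons u a).
  move=> y [[Oy cy] yG]; have [w [sw yw]] := cell_cover (size u).+1 Oy yG.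
  case/lastP: w sw yw => // w b; rewrite size_rcons => -[sw] yw.
  move: cy; rewrite /= -sw (hD_cell _ (@psi_quarter R) yw) /c sw => /sqrt_len_inj.
  (* Outside I the function psi_I is 0, which the nonzero value [c] rules out. *)
  case: eqVneq => [uw /psiq_inj <-|_ /esym/eqP]; last by rewrite (negbTE (psiq_neq0 a)).
  by rewrite (@cell_eq _ _ _ _ (rcons w b))// ?size_rcons ?sw// !pos_rcons uw.
have FE : FOm N k (size u).*2.+2 = <<s Omega N k, gens (@psi R) N k (size u) >>.
  by rewrite /FOm /= odd_double /= uphalf_double.
apply: (@atom_value _ A _ _ (len (size u).+1)) => //.
- by rewrite FE; exact: gens_fiber.
- by rewrite leb_cell size_rcons.
- exact: len_gt0.
- rewrite FE; apply: saturated_gens; first exact: cell_Omega.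
  by move=> j y z ya za; rewrite (hD_cell j (@psi_quarter R) ya) (hD_cell j (@psi_quarter R) za).
- move=> l j; rewrite (integral_psi_off_grid _ _ mA mE)//.
  by rewrite integral_cell_psi size_rcons.
Qed.

(** The atom is a quarter of I with its mirror image. Larger intervals see one value on both, psi_I
    cancels over the pair and smaller intervals integrate to 0, so the sum stops before the term of
    I. *)
Lemma g_odd u a x : cell (rcons u a) x -> g (size u).*2.+1 x = shift_value u.
Proof.
pose c := (Num.sqrt (len (size u)))^-1 * phiq a.
pose A : set (measurableTypeR R) :=
  Omega N k `&` (hD phi (level (size u)) (pos u) @^-1` [set c]).
pose a' := phi_swap true a.
have phi_a' : phiq a' = phiq a :> R by exact: phiq_swap.
have aa' : a != a' by exact: phi_swap_neq.
pose E : set (measurableTypeR R) :=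
  \big[setU/set0]_(b <- [:: a; a']) cell (rcons u b).
have EP y : E y <-> cell (rcons u a) y \/ cell (rcons u a') y.
  by rewrite /E !big_cons big_nil setU0.
have mA : measurable A by apply: measurable_fiber; exact: measurable_phi.
have mE : measurable E.
  by apply: bigsetU_measurable => b _; exact: measurable_cell.
have AO : A `<=` Omega N k by exact: subIsetl.
have hE j y : E y -> hD phi (level (size u)) j y =
    (Num.sqrt (len (size u)))^-1 * (if j == pos u then phiq a else 0).
  by move=> /EP[] ya; rewrite (hD_cell _ (@phi_quarter R) ya) ?phi_a'.
have EO : E `<=` Omega N k by move=> y /EP[]; exact: cell_Omega.
have EA : E `<=` A.
  by move=> y Ey; split; [exact: EO|rewrite /= hE// eqxx].
have AE : A `\` grid `<=` E.
  move=> y [[Oy cy] yG]; have [w [sw yw]] := cell_cover (size u).+1 Oy yG.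
  case/lastP: w sw yw => // w b; rewrite size_rcons => -[sw] yw.
  move: cy; rewrite /= -sw (hD_cell _ (@phi_quarter R) yw) /c sw => /sqrt_len_inj.
  case: eqVneq => [uw ab|_ /esym/eqP]; last by rewrite (negbTE (phiq_neq0 a)).
  have cw z : cell (rcons w z) = cell (rcons u z).
    by apply: cell_eq; rewrite ?size_rcons ?sw// !pos_rcons uw.
  apply/EP; rewrite -!cw.
  by have [<-|<-] : b = a \/ b = a' := phiq_eq (esym ab); [left|right].
have intE (h : R -> R) : measurable_fun E h -> (\int[leb]_(y in E) (h y)%:E =
    \int[leb]_(y in cell (rcons u a)) (h y)%:E +
    \int[leb]_(y in cell (rcons u a')) (h y)%:E)%E.
  move=> mh; rewrite integral_bigsetU_EFin.
  - by rewrite !big_cons big_nil addr0.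
  - by move=> b; exact: measurable_cell.
  - by rewrite /= inE aa'.
  - exact: (sub_trivIset (@subsetT _ _) (@trivIset_subcells R N k u)).
  - exact/measurable_EFinP.
have FE : FOm N k (size u).*2.+1 = <<s Omega N k, gens (@phi R) N k (size u) >>.
  by rewrite /FOm /= odd_double /= doubleK.
move=> xa; have Ex : E x by apply/EP; left.
move: x Ex {xa}; apply: (@atom_value _ A _ _ (len (size u).+1 + len (size u).+1)) => //.
- by rewrite FE; exact: gens_fiber.
- rewrite /E !big_cons big_nil setU0.
  transitivity (leb (cell (rcons u a)) + leb (cell (rcons u a')))%E.
    apply: measureU; [exact: measurable_cell|exact: measurable_cell|].
    by have /trivIsetP/(_ a a' I I aa') := @trivIset_subcells R N k u.
  by rewrite !leb_cell !size_rcons.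
- by rewrite addr_gt0 ?len_gt0.
- rewrite FE; apply: saturated_gens => // j y z Ey Ez.
  by rewrite !hE.
- move=> l j; rewrite (integral_psi_off_grid _ _ mA mE)//.
  rewrite intE; last by apply: measurable_hD; exact: measurable_psi.
  have [lu|lu|lu] := ltngtP l (size u).
  + have tk b : take l (rcons u b) = take l u by rewrite -cats1 takel_cat// ltnW.
    rewrite !integral_hD_coarse ?size_rcons 1?ltnW//=.
    by rewrite !tk !nth_rcons lu -mulrDl.
  + by rewrite !integral_hD_fine ?size_rcons// adde0.
  + rewrite !integral_hD_coarse ?size_rcons ?lu//= !nth_rcons ltnn eqxx.
    rewrite -!cats1 !take_size_cat// -mulrDr -mulrDr.
    rewrite (_ : _ + _ = 0) ?mulr0//; case: ifP => _; last by rewrite addr0.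
    exact: psiq_swap.
Qed.

Lemma g_value n x : Omega N k x -> ~ grid x ->
  exists u, [/\ size u = n./2, cell u x & g n x = shift_value u].
Proof.
move=> Ox xG; have [w [sw xw]] := cell_cover n./2.+1 Ox xG.
case/lastP: w sw xw => // w a; rewrite size_rcons => -[sw] xw.
have [no|no] := boolP (odd n).
  exists w; split=> //; first exact: cell_rcons xw.
  by rewrite -(g_odd xw) sw; congr g; lia.
case: n sw no => [/size0nil w0 _|[//|n] sw no].
  by exists [::]; split=> //; rewrite w0 in xw; [|apply: g_zero]; exact: cell_rcons xw.
(* A positive even time resolves the quarters of the previous generation, so the last letter is
   split off. *)
have xw' := cell_rcons xw; case/lastP: w {xw} sw xw' => // w b.
rewrite size_rcons => -[sw] xw'; exists (rcons w b); split=> //.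
  by rewrite size_rcons sw.
by rewrite -(g_even xw') sw; congr g; lia.
Qed.

End Atoms.

(** * Level sets of the maximal function *)

Lemma pos_inj (k : int) (u w : word) :
  size u = size w -> pos k u = pos k w -> u = w.
Proof.
elim/last_ind: u w => [|u a ih] w; first by case: w.
case/lastP: w => [|w b]; rewrite !size_rcons //= => -[sw].
rewrite !pos_rcons => e; have := ltn_ord a; have := ltn_ord b => b4 a4.
have puw : pos k u = pos k w by lia.
have ab : a = b by apply: val_inj => /=; lia.
by rewrite ab (ih _ sw puw).
Qed.

Lemma le_measure_bigsetU d (T : measurableType d) (R : realType)
    (mu : {measure set T -> \bar R}) (I : Type) (s : seq I) (F : I -> set T) :
  (forall i, measurable (F i)) ->
  (mu (\big[setU/set0]_(i <- s) F i) <= \sum_(i <- s) mu (F i))%E.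
Proof.
move=> mF; elim: s => [|i s ih]; first by rewrite !big_nil measure0.
rewrite !big_cons; apply: le_trans (measureU2 _ _ _) _ => //.
  by apply: bigsetU_measurable.
exact: leeD.
Qed.

Section LebesgueOuter.
Context {R : realType}.
Implicit Types A : set (measurableTypeR R).

(* [leb] is an outer measure, hence monotone on nonmeasurable sets as well. *)
Lemma le_leb A1 A2 : A1 `<=` A2 -> (leb A1 <= leb A2)%E.
Proof.
rewrite /leb /lebesgue_measure /lebesgue_stieltjes_measure /measure_extension.
by move=> A12; apply: le_mu_ext.
Qed.

Lemma leb_ge0 A : (0 <= leb A)%E.
Proof. by rewrite -(measure0 leb); apply: le_leb. Qed.

End LebesgueOuter.

Section LevelSets.
Context {R : realType} {B : completeNormedModType R} (N k : int) (C : R).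
Variables (f : R -> B) (gamma : int * int -> R).
Hypothesis C_ge0 : 0 <= C.
Hypothesis tree_bound :
  forall (M : nat) (F : word -> B) (a : word -> R) (gamma : word -> R) (lam : R),
  (forall u, F u = 4^-1 *: \sum_b F (rcons u b)) ->
  (forall u, a u = 4^-1 * \sum_b a (rcons u b)) ->
  (forall u, `|F u| <= a u) -> (forall u, `|gamma u| <= 1) -> 0 < lam ->
  lam * #|[pred x : M.-tuple 'I_4 |
    [exists m : 'I_M.+1, lam <= `|shift_fun F gamma (take m x)|]]|%:R <=
  C * (4 ^+ M * a [::]).
Hypothesis f_int : bochner_integrable leb setT f.
Hypothesis gamma1 : forall I, `|gamma I| <= 1.
Hypothesis f_fin : (\int[leb]_(x in Omega N k) `|f x|%:E < +oo)%E.
Implicit Types (u w : word) (lam : R) (M : nat).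
Local Notation len := (@len R N).
Local Notation cell := (@cell R N k).
Local Notation grid := (@grid R N k).
Local Notation value := (shift_value N k f gamma).

Let K : R := fine (\int[leb]_(x in Omega N k) `|f x|%:E)%E.

Lemma norm_integrable u : leb.-integrable (cell u) (EFin \o (fun x => `|f x|)).
Proof.
have [v fv] := f_int.
have mO := measurable_Omega N k (R := R).
apply: (integrableS mO (measurable_cell N k u) (@cell_Omega R N k u)).
apply/integrableP; split.
  apply/measurable_EFinP; apply: measurable_funTS.
  exact: bochner_measurable_norm fv.
by under eq_integral do rewrite /= normr_id.
Qed.

(** The scalar martingale dominating the norms of [avg], in the role of [a] in the tree bound. *)
Definition norm_avg u : R :=
  (len (size u))^-1 * fine (\int[leb]_(x in cell u) `|f x|%:E)%E.

Lemma norm_avg_split u : norm_avg u = 4^-1 * \sum_a norm_avg (rcons u a).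
Proof.
rewrite /norm_avg (integral_cell_split (norm_integrable u)) -sum_fine; last first.
  move=> a _; apply: integrable_fin_num; first exact: measurable_cell.
  exact: norm_integrable.
rewrite !mulr_sumr; apply: eq_bigr => a _.
rewrite mulrA size_rcons lenS; congr (_ * _).
by field; rewrite gt_eqF// len_gt0.
Qed.

Lemma norm_avg_ge u : `|avg N k f u| <= norm_avg u.
Proof.
rewrite /norm_avg ler_pdivlMl ?len_gt0// -lee_fin fineK; first exact: norm_avg_le.
apply: integrable_fin_num; first exact: measurable_cell.
exact: norm_integrable.
Qed.

Lemma norm_avg_nil : len 0 * norm_avg [::] <= K.
Proof.
have mO := measurable_Omega N k (R := R).
rewrite /norm_avg mulVKf ?gt_eqF ?len_gt0//; apply: fine_le.
- apply: integrable_fin_num; first exact: measurable_cell.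
  exact: norm_integrable.
- by rewrite ge0_fin_numE// integral_ge0.
apply: ge0_subset_integral => //.
- exact: measurable_cell.
- have [v fv] := f_int; apply/measurable_EFinP/measurable_funTS.
  exact: bochner_measurable_norm fv.
- exact: cell_Omega.
Qed.

(** Truncated at depth M because the tree bound concerns words of one length; as a union of open
    cells it is measurable. *)
Definition large_set lam M : set (measurableTypeR R) :=
  \bigcup_(u in [set u : word | (size u <= M)%N /\ lam <= `|value u|]) cell u.

Lemma measurable_large_set lam M : measurable (large_set lam M).
Proof.
apply: (@open_measurable R); apply: bigcup_open => u _.
by rewrite cell_itv; exact: interval_open.
Qed.

(** Off the grid the set is covered by the cells of the bad words of length M. The measure [len M]
    of each cell absorbs [4 ^+ M], leaving a bound independent of M. *)
Lemma leb_large_set lam M : 0 < lam ->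
  (leb (large_set lam M) <= (C * K / lam)%:E)%E.
Proof.
move=> lam0.
have count := tree_bound M (avg_split N k f_int) norm_avg_split norm_avg_ge
  (fun u => gamma1 (level N (size u), pos k u)) lam0.
set bad := [pred x | _] in count.
pose Z : set (measurableTypeR R) := \big[setU/set0]_(x <- enum bad) cell (tval x).
have mZ : measurable Z.
  by apply: bigsetU_measurable => x _; exact: measurable_cell.
have mG := measurable_grid N k (R := R).
have sub : large_set lam M `<=` grid `|` Z.
  move=> x [u [uM lu] ux]; have [xG|xG] := pselect (grid x); [by left|right].
  have [w [wM xw]] := cell_cover M (cell_Omega ux) xG.
  have uE : u = take (size u) w.
    have su : size u = size (take (size u) w).
      by rewrite size_takel// wM.
    by apply: (pos_inj su); apply: (cell_pos su ux); exact: cell_take.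
  have wb : Tuple (introT eqP wM) \in bad.
    rewrite inE; apply/existsP; exists (Ordinal (n := M.+1) (m := size u) uM).
    by rewrite /= -uE.
  rewrite /Z -bigcup_seq; exists (Tuple (introT eqP wM)) => //=.
  by rewrite mem_enum.
apply: (@le_trans _ _ (leb (grid `|` Z))).
  apply: le_measure => //; rewrite inE; first exact: measurable_large_set.
  exact: measurableU.
apply: (le_trans (measureU2 leb mG mZ)); rewrite [X in (X + _)%E]leb_grid add0e.
apply: le_trans (le_measure_bigsetU leb _ _) _.
  by move=> x; exact: measurable_cell.
rewrite (eq_bigr (fun _ => (len M)%:E)) => [|x _]; last first.
  by rewrite [LHS]leb_cell size_tuple.
rewrite sumEFin lee_fin big_enum sumr_const ler_pdivlMr// -mulr_natr.
apply: (@le_trans _ _ (len M * (C * (4 ^+ M * norm_avg [::])))).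
  by rewrite -mulrA ler_pM2l ?len_gt0// mulrC.
rewrite mulrCA; apply: ler_wpM2l => //.
by rewrite mulrA [len M * _]mulrC len_exp norm_avg_nil.
Qed.

Lemma leb_large_set_limit lam : 0 < lam ->
  (leb (grid `|` \bigcup_M large_set lam M) <= (C * K / lam)%:E)%E.
Proof.
move=> lam0; have mG := measurable_grid N k (R := R).
have mU : measurable (\bigcup_M large_set lam M).
  by apply: bigcupT_measurable => M; exact: measurable_large_set.
apply: (le_trans (measureU2 leb mG mU)); rewrite [X in (X + _)%E]leb_grid add0e.
have cvgU := @nondecreasing_cvg_mu _ _ _ leb (large_set lam)
  (measurable_large_set lam) mU.
apply: (cvge_to_le (cvgU _)).
  move=> m n mn; apply/subsetPset => x [u [um lu] ux]; exists u => //.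
  by split=> //; exact: leq_trans um mn.
by apply: nearW => M; exact: leb_large_set.
Qed.

Variable g : nat -> R -> B.
Hypothesis g_ce : forall n, cond_exp_version N k f gamma n (g n).

(** The supremum may equal [lam] without being attained, so the level set is compared with heights
    [mu] strictly below [lam]. [le_leb] makes the comparison without a measurability proof for
    [W]. *)
Lemma weak_type_level lam : 0 < lam ->
  (lam%:E * leb [set w | Omega N k w /\
    (lam%:E <= `|ereal_sup (range (fun n => `|g n w|%:E))|)%E] <= (C * K)%:E)%E.
Proof.
move=> lam0; set W := [set w | _].
have K0 : 0 <= K by apply: fine_ge0; exact: integral_ge0.
have WU mu : 0 < mu < lam -> W `<=` grid `|` \bigcup_M large_set mu M.
  move=> /andP[mu0 mulam] x [Ox]; rewrite gee0_abs; last first.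
    by apply: (@le_trans _ _ `|g 0 x|%:E) => //; apply: ereal_sup_ubound; exists 0%N.
  move=> lamx; have [xG|xG] := pselect (grid x); [by left|right].
  have /ereal_sup_gt[_ [n _ <-]] : (mu%:E < ereal_sup (range (fun n => `|g n x|%:E)))%E.
    by apply: lt_le_trans lamx; rewrite lte_fin.
  rewrite lte_fin => mun.
  have [u [su ux gu]] := g_value f_int g_ce n Ox xG.
  exists (size u) => //; exists u => //; split=> //.
  by rewrite -gu ltW.
have Wle mu : 0 < mu < lam -> (leb W <= (C * K / mu)%:E)%E.
  move=> mulam; have /andP[mu0 _] := mulam.
  apply: le_trans (leb_large_set_limit mu0).
  by apply: le_leb; exact: WU.
have W0 : (0 <= leb W)%E by exact: leb_ge0.
have Wfin : leb W \is a fin_num.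
  rewrite ge0_fin_numE//; apply: le_lt_trans (Wle (lam / 2) _) (ltry _).
  by rewrite divr_gt0//= ltr_pdivrMr// ltr_pMr// ltr1n.
rewrite -(fineK Wfin) -EFinM lee_fin leNgt; apply/negP => lt.
set w := fine (leb W) in lt.
have CK0 : 0 <= C * K by rewrite mulr_ge0.
have w0 : 0 < w.
  by rewrite -(pmulr_rgt0 _ lam0); exact: le_lt_trans CK0 lt.
(* Strictly between [C * K / w] and [lam], so the bound at height [mu] contradicts [lt]. *)
pose mu := (C * K / w + lam) / 2.
have CKw : 0 <= C * K / w by rewrite divr_ge0// ltW.
have CKl : C * K / w < lam by rewrite ltr_pdivrMr.
have mu0 : 0 < mu by rewrite /mu; lra.
have mulam : 0 < mu < lam by rewrite mu0 /mu; lra.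
have := Wle mu mulam; rewrite -(fineK Wfin) lee_fin -/w ler_pdivlMr// leNgt.
have : C * K / w < mu by rewrite /mu; lra.
by rewrite ltr_pdivrMr// [w * _]mulrC => ->.
Qed.

End LevelSets.

Theorem theorem5p6 (R : realType) (B : completeNormedModType R) :
  UMD B ->
  exists C : R,
    forall (N k : int) (f : R -> B) (gamma : int * int -> R),
      bochner_integrable leb setT f ->
      (forall I, `|gamma I| <= 1) ->
      forall g : nat -> R -> B,
        (forall n, cond_exp_version N k f gamma n (g n)) ->
        (weakL1 (Omega N k)
           (fun w => ereal_sup (range (fun n => (`|g n w|)%:E)))
         <= C%:E * \int[leb]_(x in Omega N k) (`|f x|)%:E)%E.
Proof.
(* Adding 1 makes the constant positive, so the right-hand side is infinite whenever the integral of
   |f| is. *)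
move=> /weak_type_tree[C [C0 tree_bound]]; exists (C + 1).
move=> N k f gamma f_int gamma1 g g_ce.
have I0 : (0 <= \int[leb]_(x in Omega N k) (`|f x|)%:E)%E by exact: integral_ge0.
have [f_fin|] := ltP (\int[leb]_(x in Omega N k) (`|f x|)%:E)%E +oo%E; last first.
  by rewrite leye_eq => /eqP ->; rewrite gt0_muley ?leey// lte_fin ltr_wpDl.
apply: ub_ereal_sup => _ [lam /= lam0 <-].
apply: le_trans (weak_type_level C0 tree_bound f_int gamma1 f_fin g_ce lam0) _.
rewrite EFinM fineK ?ge0_fin_numE//; apply: lee_wpmul2r => //.
by rewrite lee_fin lerDl.
Qed.
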